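(* Let $F\in\mathbb{Q}[x,y]$ be such that $C=\{F(x,y)=0\}\subset\mathbb{A}^2$ is a smooth curve not isomorphic over $\overline{\mathbb{Q}}$ to $\mathbb{A}^1$ or to $\mathbb{A}^1_*$, and suppose there is $G\in\overline{\mathbb{Q}}[x,y]$ such that for $a=0$ and for all but finitely many $a\in\overline{\mathbb{Q}}$, the curve $V(G-a)$ is isomorphic to $\mathbb{A}^1$ and meets $C$ in exactly one point. Then the set $\{(x,y)\in\mathbb{Q}^2: F(x,y)<0\}$ satisfies the weak approximation property.
   Context: $\mathbb{A}^1_*=\mathbb{A}^1\setminus\{0\}$. A set $R\subset\mathbb{Q}^2$ satisfies the weak approximation property if for every $(x_0,y_0)\in\mathbb{Q}^2$ and every positive integer $N$ there exists $(x,y)\in R$ with $x-x_0\in N\mathbb{Z}$ and $y-y_0\in N\mathbb{Z}$. *)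

(* Defs.v *)
(* Qbar = algC (algebraic closure of Q).  Bivariate
   polynomials are {poly {poly R}}: inner variable x, outer variable y. *)
From HB Require Import structures.
From mathcomp Require Import all_boot all_order all_algebra all_field.
Set Implicit Arguments. Unset Strict Implicit. Unset Printing Implicit Defensive.
Import Order.TTheory GRing.Theory Num.Theory.
Local Open Scope ring_scope.

Definition ev2 (R : comNzRingType) (P : {poly {poly R}}) (x y : R) : R :=
  (P.[y%:P]).[x].

Definition dx (R : comNzRingType) (P : {poly {poly R}}) : {poly {poly R}} :=
  map_poly (fun q : {poly R} => q^`()) P.
Definition dy (R : comNzRingType) (P : {poly {poly R}}) : {poly {poly R}} := P^`().

Definition toQbar (F : {poly {poly rat}}) : {poly {poly algC}} :=
  map_poly (map_poly (ratr : rat -> algC)) F.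

Definition const2 (H : {poly {poly algC}}) : Prop := exists c : algC, H = c%:P%:P.

Definition smooth_curve (H : {poly {poly algC}}) : Prop :=
  [/\ ~ const2 H,
      (forall A B : {poly {poly algC}}, H = A * B -> const2 A \/ const2 B)
    & forall x y : algC, ev2 H x y = 0 -> ev2 (dx H) x y != 0 \/ ev2 (dy H) x y != 0].

(* The (reduced) curve {H = 0} in A^2(Qbar) is isomorphic to A^1:
   polynomial maps t |-> (p1 t, p2 t) and psi(x,y), mutually inverse. *)
Definition iso_A1 (H : {poly {poly algC}}) : Prop :=
  exists (p1 p2 : {poly algC}) (psi : {poly {poly algC}}),
    (forall t : algC, ev2 H p1.[t] p2.[t] = 0 /\ ev2 psi p1.[t] p2.[t] = t) /\
    (forall x y : algC, ev2 H x y = 0 ->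
       p1.[ev2 psi x y] = x /\ p2.[ev2 psi x y] = y).

(* The curve {H = 0} is isomorphic to A^1_* = A^1 \ {0} (coordinate ring
   Qbar[t, t^-1]): Laurent polynomial maps t |-> (p1 t / t^k, p2 t / t^k) and
   a regular function psi invertible on the curve, mutually inverse. *)
Definition iso_Gm (H : {poly {poly algC}}) : Prop :=
  exists (p1 p2 : {poly algC}) (k : nat) (psi : {poly {poly algC}}),
    (forall t : algC, t != 0 ->
       ev2 H (p1.[t] / t ^+ k) (p2.[t] / t ^+ k) = 0 /\
       ev2 psi (p1.[t] / t ^+ k) (p2.[t] / t ^+ k) = t) /\
    (forall x y : algC, ev2 H x y = 0 ->
       [/\ ev2 psi x y != 0,
           p1.[ev2 psi x y] / (ev2 psi x y) ^+ k = x
         & p2.[ev2 psi x y] / (ev2 psi x y) ^+ k = y]).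

Definition weak_approx (R : rat -> rat -> Prop) : Prop :=
  forall (x0 y0 : rat) (N : nat), (0 < N)%N ->
    exists x y : rat, R x y /\
      (exists k : int, x - x0 = ((N%:Z * k)%R)%:~R) /\
      (exists k : int, y - y0 = ((N%:Z * k)%R)%:~R).

(* Main.v *)
Require Import Defs.
From HB Require Import structures.
From mathcomp Require Import all_boot all_order all_algebra all_field.
From mathcomp Require Import ring.
Set Implicit Arguments. Unset Strict Implicit. Unset Printing Implicit Defensive.
Import Order.TTheory GRing.Theory Num.Theory.
Local Open Scope ring_scope.

(** On a general fibre of [G] the polynomial [F] has a single zero, simple because
    [G] is not critical along [C], so [F] is an affine coordinate of that fibre.
    Linear algebra over [K[G]] along a test curve turns this into identities
    [D(G) x = P(G, F)] and [D(G) y = Q(G, F)].  Restricted to [F = 0] they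
    parametrise [C] by the line minus some roots of [D]; as [C] is neither the line
    nor the punctured line, two roots [r1], [r2] of [D] are missed.  Comparing units
    shows that every [G - r] is irreducible, so [F] is constant, say [f_i], on
    [G = r_i].

    Let [q] be a polynomial curve with [F(q(t)) = t].  Then [G(q(t)) - r_i] vanishes
    at most at [t = f_i]; so [G o q] is constant, or it is the affine function
    sending [f_i] to [r_i].  Hence through a general point passes exactly one such
    curve, a fibre of [G].  By uniqueness it is Galois invariant, so through a general
    rational point it has rational coefficients, and moving [t] to minus infinity
    along a suitable arithmetic progression gives the required points. *)

(** * Evaluation and substitution of bivariate polynomials *)

(** Substitution with values in any [R]-algebra, so that evaluation, composition and restriction to
    a curve share one chain rule and one naturality lemma. *)
Definition sub2 (R S : comNzRingType) (iota : {rmorphism R -> S})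
    (P : {poly {poly R}}) (a b : S) : S :=
  ev2 (map_poly (map_poly iota) P) a b.

Section Evaluation.
Variable R : comNzRingType.
Implicit Types (P Q : {poly {poly R}}) (x y : R).

Lemma ev2E P x y : ev2 P x y = (horner_eval x \o horner_eval y%:P) P.
Proof. by []. Qed.

Lemma ev2D P Q x y : ev2 (P + Q) x y = ev2 P x y + ev2 Q x y.
Proof. by rewrite /ev2 !hornerE. Qed.

Lemma ev2N P x y : ev2 (- P) x y = - ev2 P x y.
Proof. by rewrite /ev2 !hornerE. Qed.

Lemma ev2B P Q x y : ev2 (P - Q) x y = ev2 P x y - ev2 Q x y.
Proof. by rewrite ev2D ev2N. Qed.

Lemma ev2M P Q x y : ev2 (P * Q) x y = ev2 P x y * ev2 Q x y.
Proof. by rewrite /ev2 !hornerM. Qed.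

Lemma ev2_exp P n x y : ev2 (P ^+ n) x y = ev2 P x y ^+ n.
Proof. by rewrite !ev2E rmorphXn. Qed.

Lemma ev2_sum (I : Type) (r : seq I) (p : pred I) (f : I -> {poly {poly R}}) x y :
  ev2 (\sum_(i <- r | p i) f i) x y = \sum_(i <- r | p i) ev2 (f i) x y.
Proof. by rewrite !ev2E rmorph_sum. Qed.

Lemma ev2C (p : {poly R}) x y : ev2 p%:P x y = p.[x].
Proof. by rewrite /ev2 hornerC. Qed.

Lemma ev2CC c x y : ev2 c%:P%:P x y = c.
Proof. by rewrite ev2C hornerC. Qed.

Lemma ev2X x y : ev2 'X x y = y.
Proof. by rewrite /ev2 hornerX hornerC. Qed.

Lemma ev2_col P x y : ev2 P x y = (map_poly (horner_eval x) P).[y].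
Proof. by rewrite /ev2 -{2}(hornerC y x) -/(horner_eval x y%:P) horner_map. Qed.

Lemma ev2_swapXY P x y : ev2 (swapXY P) x y = ev2 P y x.
Proof. exact: horner2_swapXY. Qed.

End Evaluation.

Definition ev2s := (ev2D, ev2N, ev2M, ev2_exp, ev2CC, ev2C, ev2X).

Section Substitution.
Variables (R S : comNzRingType) (iota : {rmorphism R -> S}).
Implicit Types (P Q : {poly {poly R}}) (a b : S).

Lemma sub2D P Q a b : sub2 iota (P + Q) a b = sub2 iota P a b + sub2 iota Q a b.
Proof. by rewrite /sub2 rmorphD ev2D. Qed.

Lemma sub2M P Q a b : sub2 iota (P * Q) a b = sub2 iota P a b * sub2 iota Q a b.
Proof. by rewrite /sub2 rmorphM ev2M. Qed.

Lemma sub2C (p : {poly R}) a b : sub2 iota p%:P a b = (map_poly iota p).[a].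
Proof. by rewrite /sub2 map_polyC ev2C. Qed.

Lemma sub2X a b : sub2 iota 'X a b = b.
Proof. by rewrite /sub2 map_polyX ev2X. Qed.

Lemma rmorph_sub2 (T : comNzRingType) (theta : {rmorphism S -> T})
    (kappa : {rmorphism R -> T}) P a b :
  (forall c, theta (iota c) = kappa c) ->
  theta (sub2 iota P a b) = sub2 kappa P (theta a) (theta b).
Proof.
move=> kE; rewrite /sub2 /ev2 -horner_map.
rewrite -(horner_map (map_poly theta)) /= map_polyC /= -map_poly_comp.
congr (_.[_].[_]); apply: eq_map_poly => p /=.
by rewrite -map_poly_comp; apply: eq_map_poly => c /=.
Qed.

(** An abstract [delta] covers both d/dt along a curve and the derivation tangent to a plane
    curve. *)
Lemma chain_rule (delta : S -> S) P a b :
  {morph delta : u v / u + v} ->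
  (forall u v, delta (u * v) = delta u * v + u * delta v) ->
  (forall c, delta (iota c) = 0) ->
  delta (sub2 iota P a b) =
    sub2 iota (dx P) a b * delta a + sub2 iota (dy P) a b * delta b.
Proof.
move=> dD dM dC; have d0 : delta 0 = 0 by have := dC 0; rewrite rmorph0.
have chain1 (p : {poly R}) :
    delta (map_poly iota p).[a] = (map_poly iota p^`()).[a] * delta a.
  elim/poly_ind: p => [|p c IH].
    by rewrite deriv0 !rmorph0 !horner0 mul0r d0.
  rewrite derivD derivM derivC derivX mulr1 addr0 !rmorphD !rmorphM /= map_polyX.
  rewrite map_polyC /= !hornerE dD dM IH dC; ring.
elim/poly_ind: P => [|P p IH].
  by rewrite /dx /dy deriv0 map_poly0 /sub2 rmorph0 /ev2 !horner0 !mul0r addr0.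
have -> : dx (P * 'X + p%:P) = dx P * 'X + p^`()%:P.
  apply/polyP=> i; rewrite !(coef_map_id0, coefD, coefMX, coefC) ?deriv0 // derivD.
  by case: i => [|i]; rewrite /= ?deriv0 // coef_map_id0 ?deriv0.
rewrite /dy derivD derivM derivC derivX mulr1 addr0 !(sub2D, sub2M, sub2X, sub2C).
rewrite dD dM IH chain1 /dy; ring.
Qed.

End Substitution.

Section Composition.
Variable R : comNzRingType.
Implicit Types (P A B : {poly {poly R}}) (p q : {poly R}).

Definition comp2 P A B : {poly {poly R}} := sub2 (polyC \o polyC) P A B.
Definition curve P p q : {poly R} := sub2 polyC P p q.

Lemma sub2_id P x y : sub2 idfun P x y = ev2 P x y.
Proof.
rewrite /sub2 (@eq_map_poly _ _ _ idfun) ?map_poly_id // => p.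
by rewrite map_poly_id.
Qed.

Lemma ev2_comp2 P A B x y :
  ev2 (comp2 P A B) x y = ev2 P (ev2 A x y) (ev2 B x y).
Proof.
rewrite -[RHS]sub2_id ev2E (rmorph_sub2 (kappa := idfun)) // => c.
by rewrite /= /horner_eval !hornerC.
Qed.

Lemma horner_curve P p q t : (curve P p q).[t] = ev2 P p.[t] q.[t].
Proof.
rewrite -[RHS]sub2_id -/(horner_eval t _) (rmorph_sub2 (kappa := idfun)) // => c.
exact: hornerC.
Qed.

Lemma deriv_curve P p q t :
  (curve P p q)^`().[t] =
  ev2 (dx P) p.[t] q.[t] * p^`().[t] + ev2 (dy P) p.[t] q.[t] * q^`().[t].
Proof.
rewrite /curve (@chain_rule _ _ polyC (@deriv R)).
- by rewrite !hornerE -!/(curve _ _ _) !horner_curve.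
- exact: derivD.
- exact: derivM.
- exact: derivC.
Qed.

End Composition.

(** * Gauss's lemma and common zeros *)

Section PlaneCurves.
Variable K : closedFieldType.
Implicit Types (A B F H P Q : {poly {poly K}}) (p q c : {poly K}).

Lemma nonroot_avoiding p (s : seq K) : p != 0 -> exists2 x, p.[x] != 0 & x \notin s.
Proof.
move=> p0; pose q := p * \prod_(a <- s) ('X - a%:P).
have /closed_nonrootP[x] : q != 0.
  by rewrite mulf_neq0 // monic_neq0 // monic_prod_XsubC.
rewrite rootM negb_or root_prod_XsubC => /andP[px xs].
by exists x.
Qed.

Lemma roots_of_poly p : p != 0 -> exists s : seq K, forall x, p.[x] = 0 -> x \in s.
Proof.
move=> p0; have [s ps] := closed_field_poly_normal p; exists s => x px.
have : root p x by apply/rootP.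
by rewrite ps rootZ ?lead_coef_eq0 // root_prod_XsubC.
Qed.

Lemma poly_eq_off_finite p q (s : seq K) :
  (forall x, x \notin s -> p.[x] = q.[x]) -> p = q.
Proof.
move=> e; apply/eqP; rewrite -subr_eq0; apply: contraT => nz.
have [x] := nonroot_avoiding s nz.
by rewrite !hornerE subr_eq0 => nx /e /eqP; rewrite (negPf nx).
Qed.

Lemma size_map_horner_eval P x :
  (lead_coef P).[x] != 0 -> size (map_poly (horner_eval x) P) = size P.
Proof. by move=> lx; rewrite size_map_poly_id0. Qed.

Lemma ev2_neq0 P : P != 0 -> exists x y, ev2 P x y != 0.
Proof.
move=> P0; have [x lx _] : exists2 x, (lead_coef P).[x] != 0 & x \notin [::].
  by apply: nonroot_avoiding; rewrite lead_coef_eq0.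
have /closed_nonrootP[y] : map_poly (horner_eval x) P != 0.
  by rewrite -size_poly_eq0 size_map_horner_eval // size_poly_eq0.
by rewrite /root -ev2_col; exists x, y.
Qed.

Lemma ev2_eq P Q : (forall x y, ev2 P x y = ev2 Q x y) -> P = Q.
Proof.
move=> e; apply/eqP; rewrite -subr_eq0; apply: contraT => /ev2_neq0[x [y]].
by rewrite ev2B e subrr eqxx.
Qed.

Definition constant2 P := exists c : K, P = c%:P%:P.

Definition irreducible2 F :=
  ~ constant2 F /\ forall A B, F = A * B -> constant2 A \/ constant2 B.

Lemma constant2_size P : constant2 P -> (size P <= 1)%N.
Proof. by case=> c ->; rewrite size_polyC leq_b1. Qed.

Lemma irreducible2_neq0 F : irreducible2 F -> F != 0.
Proof. by case=> nc _; apply/eqP => F0; apply: nc; exists 0; rewrite F0 !polyC0. Qed.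

Lemma dvd_vertical A r :
  map_poly (horner_eval r) A = 0 -> exists A', A = ('X - r%:P)%:P * A'.
Proof.
move=> A0; exists (map_poly (fun q => q %/ ('X - r%:P)) A).
apply/polyP => i; rewrite coefCM coef_map_id0 ?div0p // mulrC divpK //.
by rewrite -root_factor_theorem; apply/rootP; move/polyP/(_ i): A0; rewrite coef_map coef0.
Qed.

Lemma vertical_prime A B C r :
  ('X - r%:P)%:P * C = A * B ->
  (exists A', A = ('X - r%:P)%:P * A') \/ (exists B', B = ('X - r%:P)%:P * B').
Proof.
move=> e; have : map_poly (horner_eval r) A * map_poly (horner_eval r) B = 0.
  rewrite -rmorphM -e rmorphM /= map_polyC /= /horner_eval !hornerE subrr polyC0.
  by rewrite mul0r.
move/eqP; rewrite mulf_eq0 => /orP[]/eqP/dvd_vertical ?; by [left | right].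
Qed.

Lemma mulCCK k A : k != 0 -> k%:P%:P * (k^-1%:P%:P * A) = A.
Proof. by move=> k0; rewrite mulrA -!polyCM mulfV // !polyC1 mul1r. Qed.

(* Gauss's lemma: as [K] is closed, the content is removed one linear factor at a time. *)
Lemma gauss_split c F A B : c != 0 -> c%:P * F = A * B ->
  exists a b A' B', [/\ c = a * b, A = a%:P * A', B = b%:P * B' & F = A' * B'].
Proof.
move: {2}(size c) (leqnn (size c)) => n.
elim: n c F A B => [|n IH] c F A B; first by rewrite leqn0 size_poly_eq0 => ->.
move=> sc c0 e; have [|/closed_rootP[r]] := eqVneq (size c) 1%N.
  move/eqP/size_poly1P => [k k0 ck]; exists c, 1, (k^-1%:P%:P * A), B.
  rewrite mulr1 polyC1 mul1r ck mulCCK //; split=> //.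
  by rewrite -mulrA -e ck mulrCA mulCCK.
move=> rc; have /factor_theorem[c' cE] := rc.
have c'0 : c' != 0 by apply: contraNneq c0 => c'0; rewrite cE c'0 mul0r.
have X0 : ('X - r%:P)%:P != 0 :> {poly {poly K}} by rewrite polyC_eq0 polyXsubC_eq0.
have sc' : (size c' <= n)%N.
  by move: sc; rewrite cE size_Mmonic ?monicXsubC // size_XsubC addn2.
have e' : ('X - r%:P)%:P * (c'%:P * F) = A * B.
  by rewrite -e cE polyCM mulrCA !mulrA.
have [[A1 AE]|[B1 BE]] := vertical_prime e'.
  have [|a [b [A' [B' [h1 h2 h3 h4]]]]] := IH c' F A1 B sc' c'0.
    by apply: (mulfI X0); rewrite e' AE mulrA.
  exists (a * ('X - r%:P)), b, A', B'; split=> //; first by rewrite cE h1 mulrAC.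
  by rewrite AE h2 polyCM mulrCA mulrA.
have [|a [b [A' [B' [h1 h2 h3 h4]]]]] := IH c' F A B1 sc' c'0.
  by apply: (mulfI X0); rewrite e' BE mulrCA.
exists a, (b * ('X - r%:P)), A', B'; split=> //; first by rewrite cE h1 mulrA.
by rewrite BE h3 polyCM mulrCA mulrA.
Qed.

Lemma irreducible2_dvd_scaled c F A Q :
    irreducible2 F -> (1 < size F)%N -> c != 0 -> c%:P * A = F * Q ->
  exists Q', A = F * Q'.
Proof.
move=> [_ irrF] sF c0 /(gauss_split c0)[a [b [F' [Q' [ab Fa _ AE]]]]].
have [[k ak]|/constant2_size sF'] := irrF _ _ Fa; last first.
  move: sF; rewrite Fa ltnNge (leq_trans _ sF') //.
  by rewrite mul_polyC size_scale_leq.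
have k0 : k != 0.
  apply: contraNneq c0 => k0; move/polyC_inj: ak => ak.
  by rewrite ab ak k0 polyC0 mul0r.
exists (k^-1%:P%:P * Q'); rewrite AE Fa ak -mulrA mulrCA; congr (_ * _).
by rewrite mulCCK.
Qed.

(** The gcd over K(x) decides. If it has degree 0 in y, clearing denominators in Bezout's identity
    gives [c]; otherwise it is [F] up to a factor from K(x), which Gauss's lemma removes. *)
Lemma irreducible2_bezout F Q : irreducible2 F -> (1 < size F)%N ->
  (exists Q', Q = F * Q') \/
  (exists c U V, c != 0 /\ U * F + V * Q = c%:P).
Proof.
move=> irrF sF; have [/Bezout_coprimepP[[U V] /=]|] := boolP (coprimep F Q).
  rewrite -size_poly_eq1 => /size_poly1P[c c0 e].
  by right; exists c, U, V.
rewrite coprimep_def => ng; left.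
have F0 := irreducible2_neq0 irrF.
have /Pdiv.Idomain.dvdpP[[c1 h1] /= c10 e1] := dvdp_gcdl F Q.
have /Pdiv.Idomain.dvdpP[[c2 h2] /= c20 e2] := dvdp_gcdr F Q.
set g := gcdp F Q in ng e1 e2; rewrite -mul_polyC in e1; rewrite -mul_polyC in e2.
have [a [b [h' [g' [ab ha gb Fhg]]]]] := gauss_split c10 e1.
have [[k hk]|/constant2_size sg'] := irrF.2 _ _ Fhg.
  have k0 : k != 0 by apply: contraNneq F0 => k0; rewrite Fhg hk k0 mul0r.
  apply: (irreducible2_dvd_scaled irrF sF c20 (Q := k^-1%:P%:P * (h2 * b%:P))).
  rewrite e2 gb Fhg hk -[in RHS]mulrA [g' * (_ * _)]mulrCA mulCCK //; ring.
case/negP: ng; rewrite eqn_leq lt0n size_poly_eq0 gcdp_eq0 negb_and F0 /= andbT.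
by rewrite gb mul_polyC (leq_trans (size_scale_leq _ _)).
Qed.

Lemma irreducible2_vertical F : irreducible2 F -> (size F <= 1)%N ->
  exists r k, k != 0 /\ F = ('X - r%:P)%:P * k%:P%:P.
Proof.
move=> irrF /size1_polyC FE; set f := F`_0 in FE.
have F0 := irreducible2_neq0 irrF.
have /closed_rootP[r /factor_theorem[g fE]] : size f != 1.
  apply/eqP=> /eqP/size_poly1P[c c0 fc]; apply: irrF.1.
  by exists c; rewrite FE fc.
have [] := irrF.2 g%:P ('X - r%:P)%:P; first by rewrite FE fE polyCM.
  case=> k gk; exists r, k; rewrite FE fE polyCM gk mulrC; split=> //.
  by apply: contraNneq F0 => k0; rewrite FE fE polyCM gk k0 mul0r.
case=> k /polyC_inj/(congr1 (fun p : {poly K} => size p)).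
by rewrite size_XsubC size_polyC; case: eqP.
Qed.

(** Bezout confines the x-coordinates of common zeros to the roots of [c], and an irreducible [F] of
    positive degree in y contains no vertical line. In degree 0 the curve is itself a vertical
    line. *)
Theorem irreducible2_dvd_or_finite F Q : irreducible2 F ->
  (exists Q', Q = F * Q') \/
  (exists s : seq (K * K),
     forall x y, ev2 F x y = 0 -> ev2 Q x y = 0 -> (x, y) \in s).
Proof.
move=> irrF; have F0 := irreducible2_neq0 irrF.
have [sF|sF] := leqP (size F) 1.
  have [r [k [k0 FE]]] := irreducible2_vertical irrF sF.
  have [/dvd_vertical[Q' QE]|nz] := eqVneq (map_poly (horner_eval r) Q) 0.
    left; exists (k^-1%:P%:P * Q'); rewrite QE FE -mulrA; congr (_ * _).
    by rewrite mulCCK.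
  right; have [s hs] := roots_of_poly nz; exists [seq (r, y) | y <- s] => x y.
  rewrite FE !ev2s !hornerE => /eqP; rewrite mulf_eq0 (negPf k0) orbF subr_eq0.
  by move=> /eqP->; rewrite ev2_col => /hs ys; apply/mapP; exists y.
have [|[c [U [V [c0 e]]]]] := irreducible2_bezout Q irrF sF; first by left.
right; have [s hs] := roots_of_poly c0.
have col x : exists t : seq K, forall y, ev2 F x y = 0 -> y \in t.
  have [/dvd_vertical[F' FE]|nz] := eqVneq (map_poly (horner_eval x) F) 0.
    have [[k /polyC_inj]|/constant2_size] := irrF.2 _ _ FE.
      move/(congr1 (fun p : {poly K} => size p)).
      by rewrite size_XsubC size_polyC; case: eqP.
    move=> sF'; move: sF; rewrite FE mul_polyC ltnNge.
    by rewrite (leq_trans (size_scale_leq _ _)).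
  by have [t ht] := roots_of_poly nz; exists t => y; rewrite ev2_col => /ht.
have : exists t : seq (K * K), forall x, x \in s -> forall y, ev2 F x y = 0 -> (x, y) \in t.
  elim: {hs} s => [|x s [t ht]]; first by exists [::].
  have [t' ht'] := col x; exists ([seq (x, y) | y <- t'] ++ t) => z.
  rewrite inE => /orP[/eqP->|zs] y Fzy; rewrite mem_cat.
    by apply/orP; left; apply/mapP; exists y => //; apply: ht'.
  by rewrite ht ?orbT.
case=> t ht; exists t => x y Fxy Qxy; apply: ht => //; apply: hs.
by rewrite -(ev2C _ x y) -e !ev2s Fxy Qxy !mulr0 addr0.
Qed.

Lemma zeros_infinite H (s : seq (K * K)) : ~ constant2 H ->
  exists x y, ev2 H x y = 0 /\ (x, y) \notin s.
Proof.
move=> nc; have [sH|sH] := leqP (size H) 1.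
  have HE := size1_polyC sH; have /closed_rootP[r /rootP hr] : size H`_0 != 1.
    by apply/eqP=> /eqP/size_poly1P[c c0 hc]; apply: nc; exists c; rewrite HE hc.
  have [y _ ys] := nonroot_avoiding [seq z.2 | z <- s] (oner_neq0 {poly K}).
  exists r, y; rewrite HE ev2C hr; split=> //.
  by apply: contra ys => ys; apply/mapP; exists (r, y).
have H0 : lead_coef H != 0 by rewrite lead_coef_eq0 -size_poly_gt0 ltnW.
have [x lx xs] := nonroot_avoiding [seq z.1 | z <- s] H0.
have /closed_rootP[y /rootP hy] : size (map_poly (horner_eval x) H) != 1.
  by rewrite size_map_horner_eval // gtn_eqF.
exists x, y; rewrite ev2_col hy; split=> //.
by apply: contra xs => xs; apply/mapP; exists (x, y).
Qed.

(** This stands in for the Nullstellensatz: two finite sets cannot cover the infinitely many zeros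
    of [F]. *)
Lemma irreducible2_prime F P Q : irreducible2 F ->
  (forall x y, ev2 F x y = 0 -> ev2 P x y * ev2 Q x y = 0) ->
  (exists P', P = F * P') \/ (exists Q', Q = F * Q').
Proof.
move=> irrF PQ0.
have [|[s hs]] := irreducible2_dvd_or_finite P irrF; first by left.
have [|[t ht]] := irreducible2_dvd_or_finite Q irrF; first by right.
have [x [y [Fxy]]] := zeros_infinite (s ++ t) irrF.1.
rewrite mem_cat negb_or => /andP[xys xyt].
have /eqP := PQ0 _ _ Fxy; rewrite mulf_eq0 => /orP[]/eqP.
  by move=> /hs; rewrite Fxy (negPf xys) => /(_ erefl).
by move=> /ht; rewrite Fxy (negPf xyt) => /(_ erefl).
Qed.

Lemma ev2_surjective P (a : K) : ~ constant2 P -> exists x y, ev2 P x y = a.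
Proof.
move=> nc; have [|x [y [e _]]] := @zeros_infinite (P - a%:P%:P) [::].
  case=> d e; apply: nc; exists (d + a).
  by rewrite !polyCD -e subrK.
by exists x, y; apply/eqP; rewrite -subr_eq0 -[a](ev2CC _ x y) -ev2B e.
Qed.

End PlaneCurves.

(** * Functions critical along a curve *)

(** A zero column, added to make the matrix square, kills the determinant; over a domain this yields
    a left kernel vector. *)
Lemma left_dependence (R : idomainType) n (r : 'I_n.+1 -> 'I_n -> R) :
  exists2 v : 'I_n.+1 -> R, exists i, v i != 0 &
    forall j, \sum_i v i * r i j = 0.
Proof.
pose A := \matrix_(i < n.+1, j < n.+1) oapp (r i) 0 (unlift ord0 j).
have /eqP/det0P[v v0 vA] : \det A = 0.
  rewrite (expand_det_col _ ord0) big1 // => i _.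
  by rewrite mxE unlift_none mul0r.
exists (v ord0) => [|j].
  have /existsP[i vi] : [exists i, v ord0 i != 0].
    apply: contraNT v0; rewrite negb_exists => /forallP v0.
    by apply/eqP/rowP => i; rewrite mxE; apply/eqP; rewrite -[_ == _]negbK v0.
  by exists i.
have := congr1 (fun M : 'rV_n.+1 => M ord0 (lift ord0 j)) vA; rewrite mxE [X in _ = X]mxE => e.
by rewrite -[RHS]e; apply: eq_bigr => i _; rewrite mxE liftK.
Qed.

Section Derivations.
Variable R : comNzRingType.
Implicit Types P Q : {poly {poly R}}.

Lemma dxE P : dx P = swapXY (swapXY P)^`().
Proof.
apply/polyP => i; apply/polyP => j.
by rewrite coef_swapXY coef_deriv coefMn coef_swapXY coef_map_id0 ?deriv0 // coef_deriv.
Qed.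

Lemma dxD : {morph @dx R : P Q / P + Q}.
Proof. by move=> P Q; rewrite !dxE rmorphD derivD rmorphD. Qed.

Lemma dxM P Q : dx (P * Q) = dx P * Q + P * dx Q.
Proof. by rewrite !dxE rmorphM derivM rmorphD !rmorphM /= !swapXYK. Qed.

Lemma dxC (p : {poly R}) : dx p%:P = p^`()%:P.
Proof. by rewrite dxE swapXY_polyC deriv_map swapXY_map_polyC. Qed.

End Derivations.

(** Torsion-freeness is a hypothesis so that coefficients in K and in K[x] are both covered. *)
Lemma deriv_neq0 (R : nzRingType) (p : {poly R}) :
  (forall (a : R) n, a *+ n.+1 = 0 -> a = 0) -> (1 < size p)%N -> p^`() != 0.
Proof.
move=> torfree sp; apply/eqP => /polyP/(_ (size p).-2).
have sE : (size p).-2.+1 = (size p).-1 by case: (size p) sp => [|[]].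
rewrite coef_deriv coef0 sE => e; move: sp.
have /eqP : lead_coef p = 0 by apply: (torfree _ (size p).-2); rewrite sE lead_coefE e.
by rewrite lead_coef_eq0 => /eqP ->; rewrite size_poly0.
Qed.

Section Sard.
Variable K : numClosedFieldType.
Implicit Types (F G P : {poly {poly K}}).

Lemma mulrSn_eq0 (a : K) n : a *+ n.+1 = 0 -> a = 0.
Proof. by move/eqP; rewrite mulrn_eq0 => /eqP. Qed.

Lemma poly_mulrSn_eq0 (p : {poly K}) n : p *+ n.+1 = 0 -> p = 0.
Proof.
move/polyP => e; apply/polyP => i; have := e i.
by rewrite coefMn coef0 => /mulrSn_eq0.
Qed.

(** Modulo [F], over K(x), the powers 1, G, ..., G^n lie in a space of dimension [n], the degree of
    [F] in y. Their dependence is a relation between [G] and the coordinate x. *)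
Lemma algebraic_dependence F G : irreducible2 F ->
  exists2 P, P != 0 & exists Q, comp2 P G 'X%:P = F * Q.
Proof.
move=> irrF; have [sF|sF] := leqP (size F) 1.
  have [r [k [k0 ->]]] := irreducible2_vertical irrF sF.
  exists ('X - r%:P%:P); first by rewrite polyXsubC_eq0.
  exists (k^-1%:P%:P); rewrite -mulrA -!polyCM mulfV // mulr1.
  by apply: ev2_eq => x y; rewrite ev2_comp2 !ev2s !hornerE.
set n := (size F).-1; have sFE : size F = n.+1 by rewrite prednK // ltnW.
have [v [i0 vi0] vr] :=
  @left_dependence {poly K} n (fun i j => ((G ^+ i) %% F)`_j).
(* Pseudo-division by [F] multiplies [G ^+ i] by a power of the leading coefficient, absorbed
   here. *)
pose c i := v i * lead_coef F ^+ scalp (G ^+ i) F.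
pose P : {poly {poly K}} := \sum_(i < n.+1) (c i)%:P * 'X^i.
have F0 := irreducible2_neq0 irrF.
exists (swapXY P).
  rewrite swapXY_eq0; apply/eqP => /polyP/(_ i0).
  rewrite coef_sum coef0 (bigD1 i0) //= big1 => [|i ne]; last first.
    by rewrite coefCM coefXn eq_sym (inj_eq val_inj) (negPf ne) mulr0.
  rewrite coefCM coefXn eqxx mulr1 addr0 => /eqP.
  by rewrite mulf_eq0 (negPf vi0) expf_eq0 lead_coef_eq0 (negPf F0) andbF.
exists (\sum_(i < n.+1) (v i)%:P * (G ^+ i %/ F)).
transitivity (\sum_(i < n.+1) (c i)%:P * G ^+ i).
  apply: ev2_eq => x y; rewrite ev2_comp2 ev2_swapXY !ev2s !ev2_sum !hornerE.
  by apply: eq_bigr => i _; rewrite !ev2s.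
transitivity (\sum_(i < n.+1) (v i)%:P * ((G ^+ i %/ F) * F + G ^+ i %% F)).
  apply: eq_bigr => i _.
  by rewrite -Pdiv.Idomain.divp_eq -mul_polyC mulrA -polyCM.
under eq_bigr do rewrite mulrDr.
rewrite big_split /= [X in _ + X](_ : _ = 0) ?addr0.
  by rewrite mulr_sumr; apply: eq_bigr => i _; ring.
apply/polyP => j; rewrite coef_sum coef0.
have [jn|nj] := ltnP j n.
  by rewrite -[RHS](vr (Ordinal jn)); apply: eq_bigr => i _; rewrite coefCM.
rewrite big1 // => i _; rewrite coefCM nth_default ?mulr0 //.
by rewrite (leq_trans _ nj) // -ltnS (leq_trans (ltn_modpN0 _ F0)) // sFE.
Qed.

(** The derivation tangent to [F] kills [G] modulo [F]. Applied to a relation P(G, x) = 0 on the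
    curve, it leaves the derivative of [P] in its second variable times [dy F], which [F] does not
    divide; so that derivative is again a relation. Descent on the degree ends with a relation in
    [G] alone. *)
Theorem critical_curve_values F G : irreducible2 F ->
    (exists Q, dx F * dy G - dy F * dx G = F * Q) ->
  exists2 phi : {poly K}, phi != 0 & forall x y, ev2 F x y = 0 -> phi.[ev2 G x y] = 0.
Proof.
move=> irrF [J JE]; have [sF|sF] := leqP (size F) 1.
  (* On a vertical line the hypothesis says that [G] has zero derivative along it. *)
  have [r [k [k0 FE]]] := irreducible2_vertical irrF sF.
  pose g := map_poly (horner_eval r) G.
  have g'0 : g^`() = 0.
    apply: (@poly_eq_off_finite _ _ _ [::]) => y _.
    have /(congr1 (fun P => ev2 P r y)) := JE.
    have -> : dx F = k%:P%:P by rewrite FE -polyCM dxC derivM derivXsubC derivC mul1r mulr0 addr0.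
    have -> : dy F = 0 by rewrite /dy FE -polyCM derivC.
    rewrite mul0r subr0 FE !ev2s !hornerE subrr !mul0r.
    by rewrite deriv_map -ev2_col => /eqP; rewrite mulf_eq0 (negPf k0) /= => /eqP ->.
  have sg : (size g <= 1)%N.
    by rewrite leqNgt; apply/negP => /(deriv_neq0 mulrSn_eq0); rewrite g'0 eqxx.
  exists ('X - (g`_0)%:P) => [|x y]; first by rewrite polyXsubC_eq0.
  rewrite FE !ev2s !hornerE => /eqP; rewrite mulf_eq0 (negPf k0) orbF subr_eq0.
  by move=> /eqP->; rewrite ev2_col -/g (size1_polyC sg) coefC /= hornerC subrr.
have nF : ~ exists Q, dy F = F * Q.
  case=> Q /(congr1 (fun p : {poly {poly K}} => size p)).
  have := deriv_neq0 poly_mulrSn_eq0 sF; have := lt_size_deriv (irreducible2_neq0 irrF).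
  rewrite -/(dy F) => lt nz e.
  have Q0 : Q != 0.
    by apply: contraNneq nz => Q0; rewrite -size_poly_eq0 e Q0 mulr0 size_poly0.
  move: lt; rewrite e ltnNge size_mul ?(irreducible2_neq0 irrF) //.
  by rewrite -(prednK (_ : 0 < size Q)%N) ?size_poly_gt0 // addnS leq_addr.
pose D P := dy F * dx P - dx F * dy P.
have DD : {morph D : u v / u + v} by move=> u v; rewrite /D dxD /dy derivD; ring.
have DM u v : D (u * v) = D u * v + u * D v by rewrite /D dxM /dy derivM; ring.
have DC c : D ((polyC \o polyC) c) = 0.
  by rewrite /D /= dxC /dy !derivC polyC0 !mulr0 subr0.
have [P P0 PQ] := algebraic_dependence G irrF.
move: {2}(size P) (leqnn (size P)) => n.
elim: n P P0 PQ => [|n IH] P P0 [Q PQ] sP.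
  by move: sP; rewrite leqn0 size_poly_eq0 (negPf P0).
have [sP1|sP1] := leqP (size P) 1.
  exists P`_0.
    by apply: contraNneq P0 => P0; rewrite (size1_polyC sP1) P0 polyC0.
  move=> x y Fxy; rewrite -(ev2C _ _ x) -(size1_polyC sP1).
  have /(congr1 (fun P => ev2 P x y)) := PQ.
  by rewrite ev2_comp2 ev2M Fxy mul0r !ev2s hornerX.
apply: (IH P^`()); first exact: deriv_neq0 poly_mulrSn_eq0 sP1; last first.
  by rewrite -ltnS (leq_trans (lt_size_deriv P0)).
have := chain_rule P G 'X%:P DD DM DC.
rewrite -/(comp2 P G 'X%:P) PQ DM -/(comp2 _ G 'X%:P) -/(comp2 _ G 'X%:P).
have -> : D F = 0 by rewrite /D mulrC subrr.
have -> : D 'X%:P = dy F.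
  by rewrite /D dxC derivX /dy derivC mulr0 subr0 mulr1.
have -> : D G = - (F * J) by rewrite -JE /D opprB.
rewrite mul0r add0r => e.
have [x y Fxy||//] := irreducible2_prime (P := comp2 (dy P) G 'X%:P) (Q := dy F) irrF.
  have /(congr1 (fun P => ev2 P x y)) := e.
  by rewrite !ev2s Fxy !mul0r oppr0 mulr0 add0r => <-.
by [].
Qed.

End Sard.

(** * Fibres parametrised by lines *)

Section Fibres.
Variable K : numClosedFieldType.
Implicit Types (F G W P : {poly {poly K}}) (p q B h : {poly K}).

(* [t |-> (p(t), q(t))] parametrises the fibre [G = a] and inverts the
   restriction of [F] to it. *)
Definition fibre_section F G a p q :=
  [/\ forall t, ev2 F p.[t] q.[t] = t,
      forall t, ev2 G p.[t] q.[t] = a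
    & forall x y, ev2 G x y = a -> p.[ev2 F x y] = x /\ q.[ev2 F x y] = y].

Lemma fibre_section_swapXY F G a p q :
  fibre_section F G a p q -> fibre_section (swapXY F) (swapXY G) a q p.
Proof.
case=> h1 h2 h3; split=> [t|t|x y]; rewrite !ev2_swapXY //.
by case/h3.
Qed.

(** Off the critical values of [p], the polynomial p - c shares no root with its derivative, hence
    is separable. *)
Lemma distinct_preimages p : (1 < size p)%N ->
  exists crit : seq K, forall c, c \notin crit ->
    exists s, [/\ uniq s, size s = (size p).-1 & forall x, x \in s -> p.[x] = c].
Proof.
move=> sp; have p'0 := deriv_neq0 (@mulrSn_eq0 K) sp.
have [z hz] := roots_of_poly p'0; exists [seq p.[x] | x <- z] => c cz.
have spc : size (p - c%:P) = size p.
  by rewrite size_polyDl // size_polyN size_polyC (leq_ltn_trans (leq_b1 _)).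
have pc0 : p - c%:P != 0 by rewrite -size_poly_gt0 spc ltnW.
have lc0 : lead_coef (p - c%:P) != 0 by rewrite lead_coef_eq0.
have [s ps] := closed_field_poly_normal (p - c%:P).
exists s; split.
- rewrite -separable_prod_XsubC -(eqp_separable (eqp_scale _ lc0)) -ps.
  rewrite separable_poly.unlock derivB derivC subr0.
  apply/Pdiv.ClosedField.coprimepP => x /rootP; rewrite !hornerE => /eqP.
  rewrite subr_eq0 => /eqP px; apply: contraNneq cz => /hz xz.
  by apply/mapP; exists x.
- have := spc; rewrite ps size_scale // size_prod_XsubC => <- //.
move=> x xs; apply/eqP; rewrite -subr_eq0 -(hornerC c x) -hornerN -hornerD.
by rewrite ps hornerZ mulf_eq0; apply/orP; right; rewrite -[_ == _]/(root _ _) root_prod_XsubC.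
Qed.

(** A general vertical line meets the fibre in deg p points, with distinct ordinates because [F]
    recovers the parameter, while G - a has at most deg_y G zeros on it. The bound does not depend
    on [a], as [fibrewise_rational] requires. *)
Lemma fibre_section_size F G a p q : (exists x y, ev2 G x y != a) ->
  fibre_section F G a p q -> (size p <= (size G).+1)%N.
Proof.
move=> [x1 [y1 G1]] [Fpq Gpq _]; rewrite leqNgt; apply/negP => sp.
have [|crit hcrit] := @distinct_preimages p; first exact: leq_ltn_trans sp.
(* Keeping [c] off the zeros of [g] ensures that the line x = c does not lie in the fibre. *)
pose g := G.[y1%:P] - a%:P.
have g0 : g != 0.
  by apply: contraNneq G1 => /(congr1 (horner^~ x1)); rewrite !hornerE => /eqP; rewrite subr_eq0.
have [c gc /hcrit[s [us ss sc]]] := nonroot_avoiding crit g0.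
pose g2 := map_poly (horner_eval c) G - a%:P.
have g20 : g2 != 0.
  apply: contraNneq gc => /(congr1 (horner^~ y1)).
  by rewrite !hornerE -ev2_col => /eqP.
have : (size [seq q.[t] | t <- s] < size g2)%N.
  apply: max_poly_roots => //.
  apply/allP => _ /mapP[t ts ->]; rewrite rootE !hornerE -ev2_col.
    by rewrite -(sc _ ts) Gpq subrr.
  rewrite map_inj_in_uniq // => t t' ts ts' e.
  by rewrite -(Fpq t) -(Fpq t') e (sc _ ts) (sc _ ts').
rewrite size_map ss => lt; have : (size g2 <= maxn (size G) 1)%N.
  rewrite (leq_trans (size_polyD _ _)) // geq_max size_polyN size_polyC.
  by rewrite !leq_max leq_b1 size_poly orbT.
rewrite leq_max => /orP[] le; have := leq_trans lt le.
  by rewrite prednK ?(leq_ltn_trans _ sp) // leqNgt (ltn_trans _ sp).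
by rewrite prednK ?(leq_ltn_trans _ sp) // leqNgt (leq_ltn_trans _ sp).
Qed.

(** Kronecker substitution: the coefficients have degree below [M], so at y = x^M the terms occupy
    disjoint ranges of exponents and cannot cancel. *)
Lemma size_horner_Xn P M : P != 0 -> (forall i, (size (P`_i)%R <= M)%N) ->
  P.['X^M] != 0 /\ ((1 < size P)%N -> (M < size P.['X^M])%N).
Proof.
elim/poly_ind: P => [|P c IH]; first by rewrite eqxx.
have [->|P0] := eqVneq P 0.
  rewrite mul0r add0r hornerC polyC_eq0 => c0 _; split=> //.
  by rewrite size_polyC c0.
move=> _ cM; have [|nz _] := IH P0.
  by move=> i; have := cM i.+1; rewrite coefD coefMX coefC addr0.
have sc : (size c <= M)%N by have := cM 0%N; rewrite coefD coefMX coefC add0r.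
have lt : (M < size (P.['X^M] * 'X^M)%R)%N.
  by rewrite size_mulXn // -[X in (X < _)%N]addn0 ltn_add2l size_poly_gt0.
have e : size (P.['X^M] * 'X^M + c) = size (P.['X^M] * 'X^M).
  by rewrite size_polyDl // (leq_ltn_trans sc).
rewrite hornerMXaddC e; split=> //.
by rewrite -size_poly_gt0 e (leq_ltn_trans _ lt).
Qed.

Lemma curveXl G q : curve G 'X q = G.[q].
Proof.
apply: (@poly_eq_off_finite _ _ _ [::]) => t _.
by rewrite horner_curve hornerX ev2_col -[in RHS]/(horner_eval t _) -horner_map.
Qed.

Lemma curveC (g : {poly K}) p q : curve g%:P p q = g \Po p.
Proof.
apply: (@poly_eq_off_finite _ _ _ [::]) => t _.
by rewrite horner_curve ev2C horner_comp.
Qed.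

(** The graph y = x^M with [M] large works, unless [G] depends on x alone; then x = t^(n+1), y = t
    does. *)
Lemma test_curve G n : ~ constant2 G ->
  exists p q, (n < size (curve G p q))%N /\
    forall s t, p.[s] = p.[t] -> q.[s] = q.[t] -> s = t.
Proof.
move=> nc; have [sG|sG] := leqP (size G) 1.
  have GE := size1_polyC sG; have sg : (1 < size (G`_0)%R)%N.
    rewrite ltnNge; apply/negP => /size1_polyC g0; apply: nc.
    by exists G`_0`_0; rewrite -g0.
  exists 'X^(n.+1), 'X; split=> [|s t _]; last by rewrite !hornerX.
  rewrite GE curveC -[X in (_ < X)%N]prednK; last first.
    by rewrite size_poly_gt0 comp_poly_eq0 -?size_poly_gt0 ?size_polyXn // ltnW.
  rewrite size_comp_poly size_polyXn /= (leq_trans (ltnSn n)) // leqW //.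
  by rewrite leq_pmull // -ltnS prednK // ltnW.
pose M := maxn n (sizeY G).
have G0 : G != 0 by rewrite -size_poly_gt0 ltnW.
have [|_ lt] := @size_horner_Xn G M G0.
  by move=> i; rewrite leq_max max_size_coefXY orbT.
exists 'X, 'X^M; split=> [|s t]; last by rewrite !hornerX.
by rewrite curveXl (leq_ltn_trans (leq_maxl _ _) (lt sG)).
Qed.

(** Repeated division by [B]: K[t] is spanned over K[B] by the powers of t below deg B, which bounds
    its rank. *)
Lemma adic_expansion B h : (1 < size B)%N ->
  exists r : 'I_(size B).-1 -> {poly K}, h = \sum_j (r j \Po B) * 'X^j.
Proof.
move=> sB; have B0 : B != 0 by rewrite -size_poly_gt0 ltnW.
have small (g : {poly K}) : (size g < size B)%N ->
    g = \sum_(j < (size B).-1) ((g`_j)%:P \Po B) * 'X^j.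
  move=> sg; transitivity (\poly_(j < (size B).-1) g`_j); last first.
    rewrite [LHS]poly_def; apply: eq_bigr => j _; by rewrite comp_polyC mul_polyC.
  apply/polyP => j; rewrite coef_poly; case: ltnP => // le.
  by rewrite nth_default // (leq_trans _ le) // -ltnS prednK // ltnW.
move: {2}(size h) (leqnn (size h)) => n; elim: n h => [|n IH] h sh.
  by exists (fun j => (h`_j)%:P); apply: small; rewrite (leq_ltn_trans sh) // ltnW.
have [lt|le] := ltnP (size h) (size B); first by exists (fun j => (h`_j)%:P); apply: small.
have [|r1 r1E] := IH (h %/ B).
  rewrite -ltnS (leq_trans _ sh) // size_divp // ltn_subrL -subn1 subn_gt0 sB /=.
  exact: leq_trans (ltnW sB) le.
exists (fun j => r1 j * 'X + ((h %% B)`_j)%:P).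
rewrite {1}(divp_eq h B) {1}r1E {1}(small (h %% B)) ?ltn_modp // mulr_suml -big_split.
apply: eq_bigr => j _ /=; rewrite comp_polyD comp_polyM comp_polyX; ring.
Qed.

End Fibres.

(** * Inverting (G, F) rationally *)

Section Inversion.
Variable K : numClosedFieldType.
Implicit Types (F G H W P Q : {poly {poly K}}) (p q : {poly K}).

Lemma ev2_comp2C p G F x y : ev2 (comp2 p%:P G F) x y = p.[ev2 G x y].
Proof. by rewrite ev2_comp2 ev2C. Qed.

Lemma eq_off_finite_fibres G P Q (S : seq K) : ~ constant2 G ->
  (forall x y, ev2 G x y \notin S -> ev2 P x y = ev2 Q x y) -> P = Q.
Proof.
move=> nc PQ; pose Z := \prod_(b <- S) (G - b%:P%:P).
have Z0 : Z != 0.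
  rewrite prodf_seq_neq0; apply/allP => b _ /=; rewrite subr_eq0.
  by apply/eqP => Gb; apply: nc; exists b.
have /eqP : (P - Q) * Z = 0.
  apply: ev2_eq => x y; rewrite ev2M ev2B [RHS](_ : _ = 0); last by rewrite -polyC0 ev2C horner0.
  have [xyS|xyS] := boolP (ev2 G x y \in S); last by rewrite PQ // subrr mul0r.
  by rewrite /Z (big_rem _ xyS) /= !ev2s subrr mul0r mulr0.
by rewrite mulf_eq0 (negPf Z0) orbF subr_eq0 => /eqP.
Qed.

(** On the test curve [G] restricts to [B] of degree [m], and the m+1 functions 1, F, ..., F^(m-1),
    W are dependent over K[B]. A general fibre G = a meets the test curve in [m] points with
    distinct values of [F]. On the fibre the relation is a polynomial in [F] of degree below [m];
    vanishing at these points, it vanishes on the whole fibre. *)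
Theorem fibrewise_rational F G W (S : seq K) n : ~ constant2 G ->
    (forall a, a \notin S ->
       exists p q, fibre_section F G a p q /\ (size (curve W p q) <= n)%N) ->
  exists D P, D != 0 /\
    forall x y, D.[ev2 G x y] * ev2 W x y = ev2 P (ev2 G x y) (ev2 F x y).
Proof.
(* A degree of [B] above [n] guarantees that [W] has degree below [m] on a fibre. *)
move=> nc sec; have [l1 [l2 [sB inj]]] := test_curve n.+1 nc.
set B := curve G l1 l2 in sB; set m := (size B).-1.
have sB1 : (1 < size B)%N by apply: leq_ltn_trans sB.
pose h (i : 'I_m.+1) := if (i < m)%N then curve F l1 l2 ^+ i else curve W l1 l2.
have /fin_all_exists[r hr] i := adic_expansion (h i) sB1.
have [v [i0 vi0] vr] := left_dependence r.
have rel : \sum_i (v i \Po B) * h i = 0.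
  under eq_bigr do rewrite hr mulr_sumr.
  rewrite exchange_big big1 //= => j _.
  under eq_bigr do rewrite mulrA -comp_polyM.
  by rewrite -mulr_suml -raddf_sum vr raddf0 mul0r.
have [crit hcrit] := distinct_preimages sB1.
pose w (i : 'I_m) := v (widen_ord (leqnSn m) i).
have fib a : a \notin S ++ crit -> exists p q, fibre_section F G a p q /\
    \sum_(i < m) (w i).[a] *: 'X^i + (v ord_max).[a] *: curve W p q = 0.
  rewrite mem_cat negb_or => /andP[/sec[p [q [pq sW]]] /hcrit[s [us ss sa]]].
  exists p, q; split=> //; set T := _ + _; have [Fpq Gpq pqK] := pq.
  have Ga t : t \in s -> ev2 G l1.[t] l2.[t] = a by rewrite -horner_curve => /sa.
  have sT : (size T <= m)%N.
    have sW' : (size (curve W p q) <= m)%N.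
      by rewrite (leq_trans sW) // -ltnS prednK ?(ltn_trans _ sB) // ltnW // ltnW.
    rewrite (leq_trans (size_polyD _ _)) // geq_max (leq_trans (size_scale_leq _ _)) // andbT.
    rewrite (leq_trans (size_sum _ _ _)) //; apply/bigmax_leqP => i _.
    by rewrite (leq_trans (size_scale_leq _ _)) // size_polyXn.
  apply/eqP; apply: contraT => T0.
  have : (size [seq (curve F l1 l2).[t] | t <- s] < size T)%N.
    apply: max_poly_roots => //.
      apply/allP => _ /mapP[t ts ->]; apply/rootP.
      have [e1 e2] := pqK _ _ (Ga _ ts).
      have := congr1 (horner^~ t) rel; rewrite horner0 => <-.
      rewrite big_ord_recr /= /h ltnn !hornerE !horner_sum !horner_curve e1 e2.
      rewrite horner_comp horner_curve Ga // ; congr (_ + _).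
      apply: eq_bigr => i _; rewrite /= ltn_ord !hornerE horner_comp.
      by rewrite !horner_curve Ga.
    rewrite map_inj_in_uniq // => t t' ts ts'; rewrite !horner_curve => e.
    have [e1 e2] := pqK _ _ (Ga _ ts); have [e1' e2'] := pqK _ _ (Ga _ ts').
    by apply: inj; [rewrite -e1 e e1' | rewrite -e2 e e2'].
  by rewrite size_map ss ltnNge sT.
pose D := v ord_max; pose P : {poly {poly K}} := - \sum_(i < m) (w i)%:P * 'X^i.
exists D, P; split.
  (* Without the term in [W], the powers of [F] being independent on a general fibre, the whole
     relation would be trivial. *)
  apply: contraNneq vi0 => D0.
  have w0 i : w i = 0.
    apply: (@poly_eq_off_finite _ _ _ (S ++ crit)) => a /fib[p [q [_]]].
    rewrite -/D D0 horner0 scale0r addr0 => /polyP/(_ i).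
    rewrite coef_sum (bigD1 i) //= big1 => [|j ne]; last first.
      by rewrite coefZ coefXn eq_sym (inj_eq val_inj) (negPf ne) mulr0.
    by rewrite coefZ coefXn eqxx mulr1 addr0 coef0.
  have [lt|] := ltnP i0 m.
    by rewrite -(w0 (Ordinal lt)); apply/eqP; congr (v _); apply: val_inj.
  move=> le; rewrite -[0]D0; apply/eqP; congr (v _); apply: val_inj; apply/eqP.
  by rewrite eqn_leq le -ltnS ltn_ord.
suff e : comp2 D%:P G F * W = comp2 P G F.
  by move=> x y; rewrite -ev2_comp2 -e ev2M ev2_comp2C.
apply: (eq_off_finite_fibres (S := S ++ crit) nc) => x y /fib[p [q [[_ _ pqK]]]].
have [e1 e2] := pqK _ _ (erefl (ev2 G x y)).
move/(congr1 (horner^~ (ev2 F x y))); rewrite !hornerE horner_curve e1 e2.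
rewrite ev2M ev2_comp2C ev2_comp2 ev2N ev2_sum horner_sum => /eqP.
rewrite addrC addr_eq0 => /eqP ->; congr (- _); apply: eq_bigr => i _.
by rewrite !ev2s !hornerE.
Qed.

End Inversion.

(** * Reduced inverses and irreducibility of the fibres *)

Section CommonDenominator.
Variable K : numClosedFieldType.
Implicit Types (F G H P Q : {poly {poly K}}) (D p q : {poly K}).

(** Substitute x = P/D, y = Q/D and multiply by a power of [D]. The values [u], [f], [x], [y] are
    free, so this serves parametrised curves as well as the plane. *)
Lemma clear_denominators D P Q H :
  exists N R, forall u f x y, D.[u] * x = ev2 P u f -> D.[u] * y = ev2 Q u f ->
    D.[u] ^+ N * ev2 H x y = ev2 R u f.
Proof.
have clear1 p : exists N R, forall u f x, D.[u] * x = ev2 P u f ->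
    D.[u] ^+ N * p.[x] = ev2 R u f.
  elim/poly_ind: p => [|p c [N [R IH]]].
    by exists 0%N, 0 => u f x _; rewrite horner0 mulr0 -polyC0 ev2C horner0.
  exists N.+1, (R * P + c%:P%:P * (D ^+ N.+1)%:P) => u f x e.
  rewrite !ev2s -(IH _ _ _ e) -e hornerMXaddC horner_exp exprS; ring.
elim/poly_ind: H => [|H p [N [R IH]]].
  by exists 0%N, 0 => u f x y _ _; rewrite -polyC0 !ev2C !horner0 mulr0.
have [N' [R' IH']] := clear1 p.
exists (N.+1 + N')%N, (R * Q * (D ^+ N')%:P + R' * (D ^+ N.+1)%:P) => u f x y e1 e2.
rewrite !ev2s -(IH _ _ _ _ e1 e2) -(IH' _ _ _ e1) -e2 !horner_exp exprD exprS; ring.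
Qed.

Definition inverts F G D P Q := forall x y,
  D.[ev2 G x y] * x = ev2 P (ev2 G x y) (ev2 F x y) /\
  D.[ev2 G x y] * y = ev2 Q (ev2 G x y) (ev2 F x y).

Definition generically_sectioned F G :=
  exists S : seq K, forall a, a \notin S -> exists p q, fibre_section F G a p q.

Lemma inverse_exists F G : ~ constant2 G -> generically_sectioned F G ->
  exists D P Q, D != 0 /\ inverts F G D P Q.
Proof.
move=> nc [S sec]; have ne a : exists x y, ev2 G x y != a.
  have [x [y e]] := ev2_surjective (a + 1) nc; exists x, y.
  by rewrite e -subr_eq0 addrC addKr oner_neq0.
have ne' a : exists x y, ev2 (swapXY G) x y != a.
  by have [x [y]] := ne a; exists y, x; rewrite ev2_swapXY.
have cX p q : curve 'X%:P p q = p by rewrite curveC comp_polyX.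
have cY p q : curve 'X p q = q by rewrite /curve sub2X.
have [|D1 [P [D10 e1]]] := @fibrewise_rational _ F G 'X%:P S (size G).+1 nc.
  move=> a /sec[p [q pq]]; exists p, q; rewrite cX; split=> //.
  exact: fibre_section_size (ne a) pq.
have [|D2 [Q [D20 e2]]] := @fibrewise_rational _ F G 'X S (size (swapXY G)).+1 nc.
  move=> a /sec[p [q pq]]; exists p, q; rewrite cY; split=> //.
  exact: fibre_section_size (ne' a) (fibre_section_swapXY pq).
exists (D1 * D2), (P * D2%:P), (Q * D1%:P); split; first by rewrite mulf_neq0.
move=> x y; rewrite !ev2s -e1 -e2 !ev2s !hornerE; split; ring.
Qed.

Definition reduced D P Q := forall r, D.[r] = 0 ->
  (map_poly (horner_eval r) P != 0) || (map_poly (horner_eval r) Q != 0).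

(** A common factor X - r of [D], [P], [Q] cancels off the fibre G = r, and the identities extend
    across it by [eq_off_finite_fibres]. *)
Lemma reduced_inverse F G : ~ constant2 G -> generically_sectioned F G ->
  exists D P Q, [/\ D != 0, inverts F G D P Q & reduced D P Q].
Proof.
move=> nc sec; have [D [P [Q [D0 inv]]]] := inverse_exists nc sec.
move: {2}(size D) (leqnn (size D)) => n.
elim: n D P Q D0 inv => [|n IH] D P Q D0 inv sD.
  by rewrite leqn0 size_poly_eq0 (negPf D0) in sD.
have [s hs] := roots_of_poly D0.
pose bad r := [&& root D r, map_poly (horner_eval r) P == 0
                & map_poly (horner_eval r) Q == 0].
have [/hasP[r _ /and3P[/factor_theorem[D' DE] /eqP P0 /eqP Q0]]|/hasPn ok] := boolP (has bad s).
  have [P' PE] := dvd_vertical P0; have [Q' QE] := dvd_vertical Q0.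
  have D'0 : D' != 0 by apply: contraNneq D0 => D'0; rewrite DE D'0 mul0r.
  apply: (IH D' P' Q') => //; last first.
    by move: sD; rewrite DE size_Mmonic ?monicXsubC // size_XsubC addn2.
  have cancel W (R R' : {poly {poly K}}) : R = ('X - r%:P)%:P * R' ->
      (forall x y, D.[ev2 G x y] * ev2 W x y = ev2 R (ev2 G x y) (ev2 F x y)) ->
      forall x y, D'.[ev2 G x y] * ev2 W x y = ev2 R' (ev2 G x y) (ev2 F x y).
    move=> RE e; suff E : comp2 D'%:P G F * W = comp2 R' G F.
      by move=> x y; rewrite -ev2_comp2 -E ev2M ev2_comp2C.
    apply: (eq_off_finite_fibres (S := [:: r]) nc) => x y.
    rewrite inE -subr_eq0 => nr; apply: (mulfI nr).
    have e' := e x y; rewrite RE DE !ev2s !hornerE in e'.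
    by rewrite ev2M ev2_comp2C ev2_comp2 -e'; ring.
  move=> x y; have := cancel 'X%:P _ _ PE _ x y; have := cancel 'X _ _ QE _ x y.
  rewrite !ev2s hornerX => h1 h2; split.
    by apply: h2 => a b; rewrite !ev2s hornerX; have [] := inv a b.
  by apply: h1 => a b; rewrite !ev2s; have [] := inv a b.
exists D, P, Q; split=> // r Dr; have := ok _ (hs _ Dr).
by rewrite /bad rootE Dr eqxx /= negb_and.
Qed.

(** [G] attains every value r, so the numerator vanishes at each root of the denominator and X - r
    cancels. *)
Lemma polynomial_in_quotient G H D p : ~ constant2 G -> D != 0 ->
    (forall x y, D.[ev2 G x y] * ev2 H x y = p.[ev2 G x y]) ->
  exists q, forall x y, ev2 H x y = q.[ev2 G x y].
Proof.
move=> nc; move: {2}(size D) (leqnn (size D)) => n.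
elim: n D p => [|n IH] D p sD D0; first by rewrite leqn0 size_poly_eq0 (negPf D0) in sD.
move=> e; have [/eqP/size_poly1P[c c0 Dc]|/closed_rootP[r /rootP Dr]] := eqVneq (size D) 1%N.
  by exists (c^-1 *: p) => x y; rewrite hornerZ -e Dc hornerC mulKf.
have pr : p.[r] = 0.
  by have [x [y Gr]] := ev2_surjective r nc; have := e x y; rewrite Gr Dr mul0r.
have /factor_theorem[D' DE] : root D r by apply/rootP.
have /factor_theorem[p' pE] : root p r by apply/rootP.
have D'0 : D' != 0 by apply: contraNneq D0 => D'0; rewrite DE D'0 mul0r.
apply: (IH D' p') => //.
  by move: sD; rewrite DE size_Mmonic ?monicXsubC // size_XsubC addn2.
suff E : comp2 D'%:P G 0 * H = comp2 p'%:P G 0.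
  by move=> x y; rewrite -(ev2_comp2C p' G 0) -E ev2M ev2_comp2C.
apply: (eq_off_finite_fibres (S := [:: r]) nc) => x y.
rewrite inE -subr_eq0 => nr; apply: (mulfI nr).
have e' := e x y; rewrite pE DE !hornerE in e'.
by rewrite ev2M !ev2_comp2C [RHS]mulrC -e'; ring.
Qed.

(* Off finitely many fibres [H] has no zeros, and it is a polynomial in the
   coordinate [F] of the fibre: hence it is constant on fibres. *)
Lemma fibre_factor F G D P Q H r : ~ constant2 G -> generically_sectioned F G ->
    D != 0 -> inverts F G D P Q ->
    (forall x y, ev2 H x y = 0 -> ev2 G x y = r) ->
  exists q, forall x y, ev2 H x y = q.[ev2 G x y].
Proof.
move=> nc [S sec] D0 inv Hr; have [N [R NR]] := clear_denominators D P Q H.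
have [s hs] := roots_of_poly D0.
have R0 i : R`_i.+1 = 0.
  apply: (@poly_eq_off_finite _ _ _ (r :: s ++ S)) => a.
  rewrite inE mem_cat !negb_or => /and3P[ar as_ /sec[p [q [Fpq Gpq _]]]].
  have Da : D.[a] != 0 by apply: contra as_ => /eqP/hs.
  have : size (map_poly (horner_eval a) R) == 1%N.
    apply: contraT => /closed_rootP[f /rootP]; rewrite -ev2_col.
    have [e1 e2] := inv p.[f] q.[f]; rewrite Fpq Gpq in e1 e2.
    rewrite -(NR _ _ _ _ e1 e2) => /eqP; rewrite mulf_eq0 expf_eq0 (negPf Da) andbF /=.
    by move=> /eqP/Hr; rewrite Gpq => ra; rewrite ra eqxx in ar.
  move/eqP/eqP/size_poly1P => [c _ /polyP/(_ i.+1)].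
  by rewrite coef_map coefC /= horner0.
apply: (@polynomial_in_quotient G H (D ^+ N) R`_0) => //; first by rewrite expf_neq0.
move=> x y; have [e1 e2] := inv x y; rewrite horner_exp (NR _ _ _ _ e1 e2).
have -> : R = (R`_0)%:P; last by rewrite coefC ev2C.
by apply/polyP => -[|i]; rewrite coefC //= R0.
Qed.

(** A factor of G - r vanishes at most on the fibre over r, hence is a polynomial in [G] by
    [fibre_factor]. Two such polynomials with product X - r cannot both be nonconstant. *)
Lemma fibre_irreducible F G r : ~ constant2 G -> generically_sectioned F G ->
  irreducible2 (G - r%:P%:P).
Proof.
move=> nc sec; have [D [P [Q [D0 inv]]]] := inverse_exists nc sec; split.
  case=> c e; apply: nc; exists (c + r); by rewrite !polyCD -e subrK.
move=> A B AB; have ABe x y : ev2 A x y * ev2 B x y = ev2 G x y - r.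
  by rewrite -ev2M -AB !ev2s.
have [|a aE] := @fibre_factor F G D P Q A r nc sec D0 inv.
  by move=> x y Axy; apply/eqP; rewrite -subr_eq0 -ABe Axy mul0r.
have [|b bE] := @fibre_factor F G D P Q B r nc sec D0 inv.
  by move=> x y Bxy; apply/eqP; rewrite -subr_eq0 -ABe Bxy mulr0.
have ab : a * b = 'X - r%:P.
  apply: (@poly_eq_off_finite _ _ _ [::]) => u _.
  have [x [y <-]] := ev2_surjective u nc.
  by rewrite hornerM -aE -bE ABe !hornerE.
have /(congr1 (fun p : {poly K} => size p)) := ab.
have ab0 : a * b != 0 by rewrite ab polyXsubC_eq0.
have [a0 b0] : a != 0 /\ b != 0 by apply/andP; rewrite -negb_or -mulf_eq0.
have const (h : {poly K}) H : (size h <= 1)%N ->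
    (forall x y, ev2 H x y = h.[ev2 G x y]) -> constant2 H.
  move=> /size1_polyC hE HE; exists h`_0; apply: ev2_eq => x y.
  by rewrite HE hE hornerC ev2CC coefC.
rewrite size_mul // size_XsubC => sab.
have [sa|sa] := leqP (size a) 1; first by left; apply: const aE.
right; apply: const bE; move: sab sa.
rewrite -(size_poly_gt0 b) in b0; case: (size a) => [|[|m]] //.
by case: (size b) b0 => [|[|k]] // _; rewrite !addnS.
Qed.

(** At a root r of [D] the identities read P(r, F) = Q(r, F) = 0 on the fibre, one of them
    nontrivial by reducedness. So [F] takes finitely many values there, and irreducibility of the
    fibre leaves one. *)
Lemma constant_on_fibre F G D P Q r : ~ constant2 G -> generically_sectioned F G ->
    inverts F G D P Q -> reduced D P Q -> D.[r] = 0 ->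
  exists f, forall x y, ev2 G x y = r -> ev2 F x y = f.
Proof.
move=> nc sec inv red Dr; have irr := fibre_irreducible r nc sec.
have [s hs] : exists s : seq K, forall x y, ev2 G x y = r -> ev2 F x y \in s.
  have /orP[nz|nz] := red _ Dr; have [s hs] := roots_of_poly nz; exists s => x y Gr;
    apply: hs; rewrite -ev2_col -Gr; have [e1 e2] := inv x y.
  - by rewrite -e1 Gr Dr mul0r.
  - by rewrite -e2 Gr Dr mul0r.
elim: s hs => [|b s IH] hs.
  by have [x [y /hs]] := ev2_surjective r nc.
have on x y : ev2 (G - r%:P%:P) x y = 0 <-> ev2 G x y = r.
  rewrite !ev2s; split=> [/eqP|->]; last by rewrite subrr.
  by rewrite subr_eq0 => /eqP.
have ev_prod t x y : ev2 (\prod_(c <- t) (F - c%:P%:P)) x y = \prod_(c <- t) (ev2 F x y - c).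
  rewrite ev2E rmorph_prod; apply: eq_bigr => c _.
  by rewrite -[LHS]/(ev2 (F - c%:P%:P) x y) !ev2s.
have [|[B BE]|[B BE]] := irreducible2_prime (P := F - b%:P%:P)
    (Q := \prod_(c <- s) (F - c%:P%:P)) irr.
- move=> x y /on/hs; rewrite inE ev_prod !ev2s => /orP[/eqP->|Fs].
    by rewrite subrr mul0r.
  by rewrite (big_rem _ Fs) /= subrr mul0r mulr0.
- exists b => x y /on e; apply/eqP; rewrite -subr_eq0.
  by have := congr1 (fun P => ev2 P x y) BE; rewrite ev2M e mul0r !ev2s => ->.
apply: IH => x y /on e; have := congr1 (fun P => ev2 P x y) BE.
rewrite ev2M e mul0r ev_prod => /eqP; rewrite prodf_seq_eq0 => /hasP[c cs] /=.
by rewrite subr_eq0 => /eqP->.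
Qed.

End CommonDenominator.

(** * Polynomial curves on which F is the parameter *)

Section UniqueCurve.
Local Notation K := algC.
Implicit Types (F G P Q : {poly {poly K}}) (D E p q : {poly K}).

(** If [F] divided the Jacobian [J], then [G] would take finitely many values on F = 0, though it
    takes all values outside [S]. So [J] has finitely many zeros there, a general fibre meets the
    curve transversally, and [F] has a single simple zero on the parameter line: it is affine in the
    parameter. *)
Lemma transversal_sections F G (S : seq K) : irreducible2 F ->
    (forall a, a \notin S -> iso_A1 (G - a%:P%:P) /\
       exists! z : K * K, ev2 F z.1 z.2 = 0 /\ ev2 G z.1 z.2 = a) ->
  generically_sectioned F G.
Proof.
move=> irrF hS; pose J := dx F * dy G - dy F * dx G.
have [dvdJ|[s hs]] := irreducible2_dvd_or_finite J irrF.
  have [phi phi0 hphi] := critical_curve_values irrF dvdJ.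
  have [a pa /hS[_ [z [[Fz Gz] _]]]] := nonroot_avoiding S phi0.
  by move: pa; rewrite -Gz hphi // eqxx.
exists (S ++ [seq ev2 G z.1 z.2 | z <- s]) => a.
rewrite mem_cat negb_or => /andP[/hS[[p [q [psi [pq_on pqK]]]] [[x0 y0] [/= [F0 G0] uniq0]]] as_].
have Gpq t : ev2 G p.[t] q.[t] = a.
  by have [+ _] := pq_on t; rewrite ev2B ev2CC => /subr0_eq.
have Ga x y : ev2 G x y = a -> ev2 (G - a%:P%:P) x y = 0.
  by move=> e; rewrite ev2B ev2CC e subrr.
pose t0 := ev2 psi x0 y0; have [px0 qy0] := pqK _ _ (Ga _ _ G0).
rewrite -/t0 in px0 qy0; pose f := curve F p q.
have only t : f.[t] = 0 -> t = t0.
  rewrite horner_curve => Ft; have := uniq0 (p.[t], q.[t]) (conj Ft (Gpq t)).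
  by case=> ex ey; rewrite /t0 ex ey; have [_ ->] := pq_on t.
have f't0 : f^`().[t0] != 0.
  rewrite deriv_curve px0 qy0; set u := p^`().[t0]; set v := q^`().[t0].
  have dG : ev2 (dx G) x0 y0 * u + ev2 (dy G) x0 y0 * v = 0.
    rewrite -px0 -qy0 -deriv_curve.
    have -> : curve G p q = a%:P.
      by apply: (@poly_eq_off_finite _ _ _ [::]) => t _; rewrite horner_curve Gpq hornerC.
    by rewrite derivC horner0.
  have dpsi : ev2 (dx psi) x0 y0 * u + ev2 (dy psi) x0 y0 * v = 1.
    rewrite -px0 -qy0 -deriv_curve.
    have -> : curve psi p q = 'X.
      apply: (@poly_eq_off_finite _ _ _ [::]) => t _.
      by rewrite horner_curve hornerX; have [] := pq_on t.
    by rewrite derivX hornerC.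
  (* If both differentials kill the tangent vector (u, v), then J != 0 makes it zero, contradicting
     [dpsi]. *)
  apply/eqP => dF; have J0 : ev2 J x0 y0 != 0.
    apply: contra as_ => /eqP/(hs _ _ F0) xs.
    by apply/mapP; exists (x0, y0).
  have Ju : ev2 J x0 y0 * u = 0.
    transitivity (ev2 (dy G) x0 y0 * (ev2 (dx F) x0 y0 * u + ev2 (dy F) x0 y0 * v)
      - ev2 (dy F) x0 y0 * (ev2 (dx G) x0 y0 * u + ev2 (dy G) x0 y0 * v)).
      by rewrite /J !ev2s; ring.
    by rewrite dF dG !mulr0 subr0.
  have Jv : ev2 J x0 y0 * v = 0.
    transitivity (ev2 (dx F) x0 y0 * (ev2 (dx G) x0 y0 * u + ev2 (dy G) x0 y0 * v)
      - ev2 (dx G) x0 y0 * (ev2 (dx F) x0 y0 * u + ev2 (dy F) x0 y0 * v)).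
      by rewrite /J !ev2s; ring.
    by rewrite dF dG !mulr0 subr0.
  have u0 : u = 0 by apply: (mulfI J0); rewrite Ju mulr0.
  have v0 : v = 0 by apply: (mulfI J0); rewrite Jv mulr0.
  by move: dpsi; rewrite u0 v0 !mulr0 addr0 => /esym/eqP; rewrite oner_eq0.
have /factor_theorem[g fg] : root f t0 by apply/rootP; rewrite horner_curve px0 qy0.
have /size_poly1P[c c0 gc] : size g == 1%N.
  apply: contraT => /closed_rootP[t /rootP gt].
  have tt0 : t = t0 by apply: only; rewrite fg hornerM gt mul0r.
  move: f't0; rewrite fg derivM derivXsubC !hornerE -tt0 gt.
  by rewrite subrr mulr0 addr0 eqxx.
have fE t : ev2 F p.[t] q.[t] = c * (t - t0).
  by rewrite -horner_curve -/f fg gc !hornerE.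
(* The inverse of t |-> c (t - t0), which turns [F] into the parameter. *)
pose l : {poly K} := c^-1 *: 'X + t0%:P.
exists (p \Po l), (q \Po l); split=> [t|t|x y Gxy]; rewrite !horner_comp ?Gpq //.
  by rewrite fE !hornerE addrK mulVKf.
have [pK qK] := pqK _ _ (Ga _ _ Gxy); set t := ev2 psi x y in pK qK.
have -> : l.[ev2 F x y] = t.
  by rewrite -{1}pK -{1}qK fE hornerD hornerZ hornerX hornerC mulKf // subrK.
by rewrite pK qK.
Qed.

Lemma single_root p b : p != 0 -> (forall t, p.[t] = 0 -> t = b) ->
  exists2 c : K, c != 0 & p = c *: ('X - b%:P) ^+ (size p).-1.
Proof.
move=> p0 only; have [s ps] := closed_field_poly_normal p.
have lc0 : lead_coef p != 0 by rewrite lead_coef_eq0.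
exists (lead_coef p) => //; have sb : s = nseq (size s) b.
  apply/all_pred1P/allP => z zs /=; apply/eqP/only/rootP.
  by rewrite ps rootZ // root_prod_XsubC.
have -> : (size p).-1 = size s by rewrite ps size_scale // size_prod_XsubC.
by rewrite {1}ps sb big_nseq iter_mulr_1 size_nseq.
Qed.

(** * Parametrisation of C and the missed fibres *)

Definition dominates_line F G :=
  exists S : seq K, forall a, a \notin S -> exists x y, ev2 F x y = 0 /\ ev2 G x y = a.

(** Putting F = 0 in [inverts] gives [D], [P.[0]], [Q.[0]]. Common factors X - r are then cancelled
    on the curve, as [F] is prime and, [G] being dominant there, does not divide G - r. *)
Lemma rational_parametrisation F G D P Q : irreducible2 F -> dominates_line F G ->
    D != 0 -> inverts F G D P Q ->
  exists E A B, [/\ E != 0, forall r, E.[r] = 0 -> D.[r] = 0,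
     forall x y, ev2 F x y = 0 ->
        E.[ev2 G x y] * x = A.[ev2 G x y] /\ E.[ev2 G x y] * y = B.[ev2 G x y]
   & forall r, E.[r] = 0 -> (A.[r] != 0) || (B.[r] != 0)].
Proof.
move=> irrF [S dom] D0 inv.
suff ind n E A B : (size E <= n)%N -> E != 0 -> (forall r, E.[r] = 0 -> D.[r] = 0) ->
    (forall x y, ev2 F x y = 0 ->
       E.[ev2 G x y] * x = A.[ev2 G x y] /\ E.[ev2 G x y] * y = B.[ev2 G x y]) ->
  exists E A B, [/\ E != 0, forall r, E.[r] = 0 -> D.[r] = 0,
     forall x y, ev2 F x y = 0 ->
        E.[ev2 G x y] * x = A.[ev2 G x y] /\ E.[ev2 G x y] * y = B.[ev2 G x y]
   & forall r, E.[r] = 0 -> (A.[r] != 0) || (B.[r] != 0)].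
  apply: (ind _ D P.[0] Q.[0] (leqnn _)) => // x y Fxy.
  by have := inv x y; rewrite Fxy /ev2 polyC0.
elim: n E A B => [|n IH] E A B sE E0 ED on.
  by rewrite leqn0 size_poly_eq0 (negPf E0) in sE.
have [s hs] := roots_of_poly E0.
have [/hasP[r _]|/hasPn ok] := boolP (has (fun r => [&& root E r, root A r & root B r]) s).
  case/and3P=> /factor_theorem[E' EE] /factor_theorem[A' AE] /factor_theorem[B' BE].
  apply: (IH E' A' B').
  - by move: sE; rewrite EE size_Mmonic ?monicXsubC ?size_XsubC ?addn2 //;
      apply: contraNneq E0 => E'0; rewrite EE E'0 mul0r.
  - by apply: contraNneq E0 => E'0; rewrite EE E'0 mul0r.
  - by move=> z E'z; apply: ED; rewrite EE hornerM E'z mul0r.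
  have cancel W p : (forall x y, ev2 F x y = 0 ->
      (ev2 G x y - r) * (E'.[ev2 G x y] * ev2 W x y - p.[ev2 G x y]) = 0) ->
      forall x y, ev2 F x y = 0 -> E'.[ev2 G x y] * ev2 W x y = p.[ev2 G x y].
    move=> e; have [|[R GR]|[R WR]] := irreducible2_prime (P := G - r%:P%:P)
       (Q := comp2 E'%:P G 0 * W - comp2 p%:P G 0) irrF.
    - by move=> x y /e; rewrite !ev2B ev2M !ev2_comp2C ev2CC.
    - have [a _] := nonroot_avoiding (r :: S) (oner_neq0 {poly K}).
      rewrite inE negb_or => /andP[ar /dom[x [y [Fxy Gxy]]]].
      have := congr1 (fun P => ev2 P x y) GR; rewrite ev2M Fxy mul0r ev2B ev2CC Gxy.
      by move/subr0_eq => e'; rewrite e' eqxx in ar.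
    move=> x y Fxy; have := congr1 (fun P => ev2 P x y) WR.
    by rewrite ev2M Fxy mul0r ev2B ev2M !ev2_comp2C => /subr0_eq.
  move=> x y Fxy; split.
    have := cancel 'X%:P A' _ x y Fxy; rewrite ev2C hornerX; apply=> a b Fab.
    have [e _] := on _ _ Fab; rewrite EE AE !hornerM !hornerXsubC in e.
    by rewrite ev2C hornerX mulrBr [X in _ - X]mulrC -e; ring.
  have := cancel 'X B' _ x y Fxy; rewrite ev2X; apply=> a b Fab.
  have [_ e] := on _ _ Fab; rewrite EE BE !hornerM !hornerXsubC in e.
  by rewrite ev2X mulrBr [X in _ - X]mulrC -e; ring.
exists E, A, B; split=> // r Er; have := ok _ (hs _ Er).
by rewrite !rootE Er eqxx /= negb_and.
Qed.

(** On the curve [G] omits the roots of [E], since [A] and [B] do not both vanish there. With no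
    root, (A/E, B/E) would be an isomorphism from the line with inverse [G]; with exactly one, from
    the punctured line, after a translation. *)
Lemma two_missed_fibres F G D P Q : irreducible2 F -> dominates_line F G ->
    D != 0 -> inverts F G D P Q -> ~ iso_A1 F -> ~ iso_Gm F ->
  exists r s, [/\ r != s, D.[r] = 0 & D.[s] = 0].
Proof.
move=> irrF dom D0 inv nA1 nGm.
have [E [A [B [E0 ED on red]]]] := rational_parametrisation irrF dom D0 inv.
have miss r x y : E.[r] = 0 -> ev2 F x y = 0 -> ev2 G x y != r.
  move=> Er Fxy; apply/eqP => Gr; have [] := on _ _ Fxy; rewrite Gr Er !mul0r.
  by have := red _ Er; case: eqP => [_|ne _ /esym //]; case: eqP => [//|ne _ _ /esym].
have [S domS] := dom.
have [/size_poly1P[c c0 Ec]|/closed_rootP[r rr]] := boolP (size E == 1%N).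
  case: nA1; exists (c^-1 *: A), (c^-1 *: B), G.
  have on' x y : ev2 F x y = 0 ->
      (c^-1 *: A).[ev2 G x y] = x /\ (c^-1 *: B).[ev2 G x y] = y.
    by move=> /on[]; rewrite Ec !hornerC !hornerZ => <- <-; rewrite !mulKf.
  split=> // t; split.
    suff e : curve F (c^-1 *: A) (c^-1 *: B) = 0 by rewrite -horner_curve e horner0.
    apply: (@poly_eq_off_finite _ _ _ S) => a /domS[x [y [Fxy Gxy]]].
    by have [e1 e2] := on' _ _ Fxy; rewrite horner_curve -Gxy e1 e2 Fxy horner0.
  suff e : curve G (c^-1 *: A) (c^-1 *: B) = 'X by rewrite -horner_curve e hornerX.
  apply: (@poly_eq_off_finite _ _ _ S) => a /domS[x [y [Fxy Gxy]]].
  by have [e1 e2] := on' _ _ Fxy; rewrite horner_curve -{1 2}Gxy e1 e2 Gxy hornerX.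
have [s hs] := roots_of_poly E0.
have [/hasP[z _ /andP[/rootP Ez zr]]|/hasPn one] := boolP (has (fun z => root E z && (z != r)) s).
  by exists z, r; split=> //; apply: ED => //; apply/rootP.
case: nGm; have [|c c0 Ec] := @single_root E r E0.
  move=> t Et; have := one _ (hs _ Et); rewrite rootE Et eqxx /= negbK.
  by move/eqP.
set k := (size E).-1 in Ec.
(* The translation moves the omitted value [r] to 0. *)
pose p1 := (c^-1 *: A) \Po ('X + r%:P); pose p2 := (c^-1 *: B) \Po ('X + r%:P).
have on' x y : ev2 F x y = 0 ->
    p1.[ev2 G x y - r] / (ev2 G x y - r) ^+ k = x /\
    p2.[ev2 G x y - r] / (ev2 G x y - r) ^+ k = y.
  move=> Fxy; have Gr : (ev2 G x y - r) ^+ k != 0.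
    by rewrite expf_neq0 // subr_eq0 miss //; apply/rootP.
  have := on _ _ Fxy; rewrite Ec hornerZ horner_exp hornerXsubC => -[e1 e2].
  rewrite !horner_comp !hornerE subrK -e1 -e2.
  by split; rewrite -!mulrA mulKf // mulrC divfK.
(* An identity on the curve holds at all but finitely many values t of G - r; clearing denominators
   makes it polynomial in t, hence valid for every t != 0. *)
have extend H (h : {poly K}) : (forall x y, ev2 F x y = 0 -> ev2 H x y = h.[ev2 G x y - r]) ->
    forall t, t != 0 -> ev2 H (p1.[t] / t ^+ k) (p2.[t] / t ^+ k) = h.[t].
  move=> Hh; have [N [R NR]] := clear_denominators 'X^k p1%:P p2%:P H.
  have {}NR t : t != 0 ->
      (t ^+ k) ^+ N * ev2 H (p1.[t] / t ^+ k) (p2.[t] / t ^+ k) = R.[0].[t].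
    move=> t0; have tk : t ^+ k != 0 by rewrite expf_neq0.
    have := NR t 0; rewrite !hornerXn !ev2C => ->; first by rewrite /ev2 polyC0.
      by rewrite mulrC divfK.
    by rewrite mulrC divfK.
  have Rh : R.[0] = 'X^k ^+ N * h.
    apply: (@poly_eq_off_finite _ _ _ (0 :: [seq a - r | a <- S])) => t.
    rewrite inE negb_or => /andP[t0 tS].
    have /domS[x [y [Fxy Gxy]]] : t + r \notin S.
      by apply: contra tS => tS; apply/mapP; exists (t + r); rewrite ?addrK.
    have := on' _ _ Fxy; have := Hh _ _ Fxy; rewrite Gxy addrK => Hxy [e1 e2].
    by rewrite -NR // e1 e2 Hxy hornerM horner_exp hornerXn.
  move=> t t0; apply: (mulfI (_ : (t ^+ k) ^+ N != 0)); first by rewrite !expf_neq0.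
  by rewrite NR // Rh hornerM horner_exp hornerXn.
exists p1, p2, k, (G - r%:P%:P); split=> [t t0|x y Fxy]; last first.
  rewrite ev2B ev2CC; have [e1 e2] := on' _ _ Fxy; split=> //.
  by rewrite subr_eq0 miss //; apply/rootP.
split; first by rewrite (extend F 0) ?horner0 // => x y ->; rewrite horner0.
rewrite (extend _ 'X) ?hornerX // => x y _.
by rewrite ev2B ev2CC hornerX.
Qed.

(** Along the curve [G] takes the value r_i at most at t = f_i, so when nonconstant it equals r_i +
    c_i (t - f_i)^d for both i. Then r1 != r2 gives f1 != f2, and such powers agree only for d =
    1. *)
Lemma curve_alternative F G r1 r2 f1 f2 p q : r1 != r2 ->
    (forall x y, ev2 G x y = r1 -> ev2 F x y = f1) ->
    (forall x y, ev2 G x y = r2 -> ev2 F x y = f2) ->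
    (forall t, ev2 F p.[t] q.[t] = t) ->
  (size (curve G p q) <= 1)%N \/
  curve G p q = r1%:P + ((r2 - r1) / (f2 - f1)) *: ('X - f1%:P).
Proof.
move=> r12 F1 F2 Fpq; set g := curve G p q.
have [|sg] := leqP (size g) 1; [by left|right].
have sgr r : size (g - r%:P) = size g.
  by rewrite size_polyDl // size_polyN size_polyC (leq_ltn_trans (leq_b1 _)).
have shape r f : (forall x y, ev2 G x y = r -> ev2 F x y = f) ->
    exists2 c, c != 0 & g = r%:P + c *: ('X - f%:P) ^+ (size g).-1.
  move=> Fr; have [||c c0] := @single_root (g - r%:P) f.
  - by rewrite -size_poly_gt0 sgr ltnW.
  - move=> t; rewrite hornerD hornerN hornerC => /subr0_eq.
    by rewrite horner_curve => /Fr; rewrite Fpq.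
  by rewrite sgr => e; exists c => //; rewrite -e addrC subrK.
have [c1 c10 g1] := shape _ _ F1; have [c2 c20 g2] := shape _ _ F2.
set d := (size g).-1 in g1 g2; have d0 : (0 < d)%N by rewrite -ltnS prednK // ltnW.
have gf1 : g.[f1] = r1.
  by rewrite g1 hornerD hornerZ horner_exp hornerXsubC subrr hornerC expr0n gtn_eqF // mulr0 addr0.
have gf2 : g.[f2] = r2.
  by rewrite g2 hornerD hornerZ horner_exp hornerXsubC subrr hornerC expr0n gtn_eqF // mulr0 addr0.
have f12 : f1 != f2 by apply: contraNneq r12 => e; rewrite -gf1 -gf2 e.
have f21 : f2 - f1 != 0 by rewrite subr_eq0 eq_sym.
have d1 : d = 1%N.
  apply/eqP; rewrite eqn_leq d0 andbT leqNgt; apply/negP => d2.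
  (* For d > 1 the derivative at [f1] vanishes by the first expression but not by the second. *)
  have dE r c f : g = r%:P + c *: ('X - f%:P) ^+ d ->
      g^`().[f1] = c * ((f1 - f) ^+ d.-1 *+ d).
    move=> ->; rewrite derivD derivC add0r derivZ deriv_exp derivXsubC mul1r.
    by rewrite hornerZ hornerMn horner_exp hornerXsubC.
  have := dE _ _ _ g1; rewrite (dE _ _ _ g2) subrr expr0n.
  have -> : d.-1 == 0%N = false by rewrite -subn1 subn_eq0 leqNgt d2.
  rewrite mul0rn mulr0 => /eqP; rewrite mulf_eq0 (negPf c20) mulrn_eq0 gtn_eqF //=.
  by rewrite expf_eq0 subr_eq0 (negPf f12) andbF.
rewrite {1}g1 d1 expr1; congr (_ + _ *: _).
have := gf2; rewrite g1 d1 expr1 hornerD hornerZ hornerXsubC hornerC => <-.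
by rewrite [r1 + _]addrC addrK mulfK.
Qed.

(** Where [Z] is nonzero the affine alternative is excluded, so every competing curve stays in the
    fibre of [G] through the point, and [inverts] recovers its coordinates from the parameter. *)
Theorem unique_curve_through_point F G (S : seq K) :
    irreducible2 F -> ~ iso_A1 F -> ~ iso_Gm F ->
    (forall a, a \notin S -> iso_A1 (G - a%:P%:P) /\
       exists! z : K * K, ev2 F z.1 z.2 = 0 /\ ev2 G z.1 z.2 = a) ->
  exists2 Z : {poly {poly K}}, Z != 0 & forall x y, ev2 Z x y != 0 ->
    exists p q,
      [/\ forall t, ev2 F p.[t] q.[t] = t, p.[ev2 F x y] = x, q.[ev2 F x y] = y
        & forall p' q', (forall t, ev2 F p'.[t] q'.[t] = t) ->
            p'.[ev2 F x y] = x -> q'.[ev2 F x y] = y -> p' = p /\ q' = q].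
Proof.
move=> irrF nA1 nGm hS.
have dom : dominates_line F G.
  by exists S => a /hS[_ [[x y] [/= h _]]]; exists x, y.
have nc : ~ constant2 G.
  case=> c Gc; have [a _] := nonroot_avoiding (c :: S) (oner_neq0 {poly K}).
  rewrite inE negb_or => /andP[ac /hS[_ [z [[_ +] _]]]].
  by rewrite Gc ev2CC => e; rewrite e eqxx in ac.
have sec := transversal_sections irrF hS.
have [D [P [Q [D0 inv red]]]] := reduced_inverse nc sec.
have [r1 [r2 [r12 Dr1 Dr2]]] := two_missed_fibres irrF dom D0 inv nA1 nGm.
have [f1 F1] := constant_on_fibre nc sec inv red Dr1.
have [f2 F2] := constant_on_fibre nc sec inv red Dr2.
pose l : {poly K} := r1%:P + ((r2 - r1) / (f2 - f1)) *: ('X - f1%:P).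
have [T secT] := sec.
(* The factors remove the exceptional fibres, the fibres over roots of [D], and the points where G =
   l(F), the only ones an affine competitor can reach. *)
pose Z := (\prod_(b <- T) (G - b%:P%:P)) * comp2 D%:P G 0 * (G - comp2 l%:P F 0).
have Gb b : G - b%:P%:P != 0.
  by rewrite subr_eq0; apply/eqP => e; apply: nc; exists b.
exists Z.
  rewrite !mulf_neq0 //.
  - by rewrite prodf_seq_neq0; apply/allP => b _ /=.
  - have [a Da _] := nonroot_avoiding [::] D0; have [x [y Gxy]] := ev2_surjective a nc.
    by apply: contraNneq Da => DG; rewrite -Gxy -(ev2_comp2C D G 0) DG -polyC0 ev2C horner0.
  apply/eqP => /subr0_eq Gl.
  have la a : a \notin T -> l = a%:P.
    move=> /secT[p [q [Fpq Gpq _]]]; apply: (@poly_eq_off_finite _ _ _ [::]) => t _.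
    by rewrite hornerC -(Gpq t) Gl ev2_comp2C Fpq.
  have [a _ aT] := nonroot_avoiding T (oner_neq0 {poly K}).
  have [b _] := nonroot_avoiding (a :: T) (oner_neq0 {poly K}).
  rewrite inE negb_or => /andP[/eqP ba bT]; apply: ba; apply: polyC_inj.
  by rewrite -!la.
move=> x y; rewrite !ev2M !mulf_eq0 !negb_or => /andP[/andP[GT DG] Gl].
rewrite ev2_comp2C in DG; rewrite ev2B ev2_comp2C subr_eq0 in Gl.
have /secT[p [q [Fpq Gpq pqK]]] : ev2 G x y \notin T.
  by apply: contra GT => xyT; rewrite (big_rem _ xyT) /= ev2M ev2B ev2CC subrr mul0r.
have [px qy] := pqK _ _ erefl.
exists p, q; split=> // p' q' Fpq' px' qy'.
have param p0 q0 : (forall t, ev2 F p0.[t] q0.[t] = t) ->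
     p0.[ev2 F x y] = x -> q0.[ev2 F x y] = y -> forall t,
     D.[ev2 G x y] * p0.[t] = ev2 P (ev2 G x y) t /\
     D.[ev2 G x y] * q0.[t] = ev2 Q (ev2 G x y) t.
  move=> Fp0 px0 qy0 t; have [/size1_polyC gE|gE] := curve_alternative r12 F1 F2 Fp0; last first.
    by case/eqP: Gl; rewrite /l -gE horner_curve px0 qy0.
  have Gt : ev2 G p0.[t] q0.[t] = ev2 G x y.
    transitivity (curve G p0 q0).[ev2 F x y].
      by rewrite -horner_curve gE !hornerC.
    by rewrite horner_curve px0 qy0.
  by have := inv p0.[t] q0.[t]; rewrite Gt Fp0.
by split; apply: (@poly_eq_off_finite _ _ _ [::]) => t _; apply: (mulfI DG);
  have [e1 e2] := param _ _ Fpq px qy t;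
  have [e1' e2'] := param _ _ Fpq' px' qy' t; rewrite ?e1 ?e2 ?e1' ?e2'.
Qed.

End UniqueCurve.

(** * Descent to the rationals *)

Section RationalDescent.

(** The roots of the minimal polynomial generate a Galois number field whose automorphisms extend to
    [algC]; so [z] lies in the fixed field, which is Q. *)
Lemma Crat_of_fixed_aut (z : algC) :
  (forall nu : {rmorphism algC -> algC}, nu z = z) -> z \in Crat.
Proof.
move=> fix_z; have [p [Dp mon_p] _] := minCpolyP z.
have [r Dr] := closed_field_poly_normal (minCpoly z).
rewrite (monicP (minCpoly_monic z)) scale1r in Dr.
have [Qr [QrC [rr Drr genQr]]] := num_field_exists r.
pose p1 : {poly Qr} := map_poly (in_alg Qr) p.
have p1E : p1 = \prod_(y <- rr) ('X - y%:P).
  apply: (map_poly_inj QrC); rewrite -map_poly_comp.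
  rewrite (@eq_map_poly _ _ _ ratr) => [|a]; last by rewrite /= alg_num_field fmorph_rat.
  rewrite -Dp Dr -Drr big_map rmorph_prod; apply: eq_bigr => y _.
  by rewrite rmorphB /= map_polyX map_polyC.
have split1 : splittingFieldFor 1 p1 {:Qr} by exists rr; rewrite -?p1E ?eqpxx.
have p1over : p1 \is a polyOver 1%AS by apply/polyOver1P; exists p.
have Qr_ax : FieldExt_isSplittingField _ Qr by constructor; exists p1.
pose Qn : splittingFieldType rat := HB.pack_for (splittingFieldType rat) Qr Qr_ax.
have gal : galois 1 {:Qn}.
  apply/and3P; split; first exact: sub1v.
    apply/separableP => u _; apply: pcharf0_separable.
    exact: ftrans (pchar_lalg _) (pchar_num _).
  by apply/splitting_normalField; [exact: sub1v | exists p1].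
have : z \in r by rewrite -root_prod_XsubC -Dr root_minCpoly.
rewrite -Drr => /mapP[z1 _ zE].
have : (z1 : Qn) \in fixedField ('Gal({:Qn} / 1))%g.
  apply/fixedFieldP; first exact: memvf.
  move=> x _; have [nu Dnu] := extend_algC_subfield_aut QrC x.
  by apply: (fmorph_inj QrC); rewrite Dnu -zE fix_z.
rewrite (galois_fixedField gal) => /vlineP[a z1E].
by apply/CratP; exists a; rewrite zE z1E alg_num_field fmorph_rat.
Qed.

Lemma rational_poly_of_fixed_aut (p : {poly algC}) :
  (forall nu : {rmorphism algC -> algC}, map_poly nu p = p) ->
  exists p0 : {poly rat}, p = map_poly ratr p0.
Proof.
move=> fix_p; have a_ i : {a : rat | p`_i = ratr a}.
  apply: sig_eqW; apply/CratP/Crat_of_fixed_aut => nu.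
  by rewrite -coef_map fix_p.
exists (\poly_(i < size p) sval (a_ i)); apply/polyP => i.
rewrite coef_map coef_poly; case: ltnP => [_|le]; first by case: (a_ i).
by rewrite nth_default // raddf0.
Qed.

Lemma ev2_toQbar (F : {poly {poly rat}}) x y :
  ev2 (toQbar F) (ratr x) (ratr y) = ratr (ev2 F x y).
Proof. by rewrite -[ev2 F x y]sub2_id (rmorph_sub2 (kappa := ratr)). Qed.

Lemma map_curve_toQbar (nu : {rmorphism algC -> algC}) (F : {poly {poly rat}}) p q :
  map_poly nu (curve (toQbar F) p q) = curve (toQbar F) (map_poly nu p) (map_poly nu q).
Proof.
have curveE u v : curve (toQbar F) u v = sub2 (polyC \o ratr) F u v.
  rewrite /curve /sub2 -map_poly_comp; congr (ev2 _ u v).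
  by apply: eq_map_poly => c /=; rewrite -map_poly_comp.
rewrite !curveE (rmorph_sub2 (kappa := polyC \o ratr)) // => c /=.
by rewrite map_polyC /= fmorph_rat.
Qed.

(** As [F] and the point are rational, every conjugate of the curve satisfies the same conditions,
    hence equals it. *)
Lemma unique_curve_rational (F : {poly {poly rat}}) (x y : rat) (p q : {poly algC}) :
    (forall t, ev2 (toQbar F) p.[t] q.[t] = t) ->
    p.[ratr (ev2 F x y)] = ratr x -> q.[ratr (ev2 F x y)] = ratr y ->
    (forall p' q', (forall t, ev2 (toQbar F) p'.[t] q'.[t] = t) ->
       p'.[ratr (ev2 F x y)] = ratr x -> q'.[ratr (ev2 F x y)] = ratr y ->
       p' = p /\ q' = q) ->
  exists p0 q0 : {poly rat}, [/\ forall t, ev2 F p0.[t] q0.[t] = t,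
    p0.[ev2 F x y] = x & q0.[ev2 F x y] = y].
Proof.
move=> Fpq px qy uniq_pq.
have fix_pq (nu : {rmorphism algC -> algC}) : map_poly nu p = p /\ map_poly nu q = q.
  apply: uniq_pq.
  - move=> t; rewrite -horner_curve -map_curve_toQbar.
    have -> : curve (toQbar F) p q = 'X.
      by apply: (@poly_eq_off_finite _ _ _ [::]) => s _; rewrite horner_curve Fpq hornerX.
    by rewrite map_polyX hornerX.
  - by rewrite -(fmorph_rat nu) horner_map px fmorph_rat.
  - by rewrite -(fmorph_rat nu) horner_map qy fmorph_rat.
have [p0 pE] := rational_poly_of_fixed_aut (fun nu => (fix_pq nu).1).
have [q0 qE] := rational_poly_of_fixed_aut (fun nu => (fix_pq nu).2).
have inj : injective (ratr : rat -> algC) := fmorph_inj _.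
exists p0, q0; split=> [t||]; apply: inj.
- by rewrite -ev2_toQbar -!horner_map /= -pE -qE Fpq.
- by rewrite -horner_map /= -pE px.
- by rewrite -horner_map /= -qE qy.
Qed.

(** * Lattice points and congruences *)

Lemma nonroot_in_progression (p : {poly algC}) (x0 : rat) N : (0 < N)%N -> p != 0 ->
  exists i : nat, p.[ratr (x0 + (N * i)%:R)] != 0.
Proof.
move=> N0 p0; pose s := [seq ratr (x0 + (N * i)%:R) : algC | i <- iota 0 (size p)].
have [/allP all_s|/allPn[_ /mapP[i _ ->] nr]] := boolP (all (root p) s); last by exists i.
have : (size s < size p)%N.
  apply: max_poly_roots => //; first exact/allP.
  rewrite map_inj_uniq ?iota_uniq // => i j /fmorph_inj/addrI/eqP.
  by rewrite eqr_nat eqn_pmul2l // => /eqP.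
by rewrite size_map size_iota ltnn.
Qed.

Lemma nonzero_on_lattice (Z : {poly {poly algC}}) (x0 y0 : rat) N : (0 < N)%N -> Z != 0 ->
  exists i j : nat, ev2 Z (ratr (x0 + (N * i)%:R)) (ratr (y0 + (N * j)%:R)) != 0.
Proof.
move=> N0 Z0; have [|i li] := @nonroot_in_progression (lead_coef Z) x0 N N0.
  by rewrite lead_coef_eq0.
have [|j nj] := @nonroot_in_progression (map_poly (horner_eval (ratr (x0 + (N * i)%:R))) Z) y0 N N0.
  by rewrite -size_poly_eq0 size_map_horner_eval // size_poly_eq0.
by exists i, j; rewrite ev2_col.
Qed.

(** Write p(t0 + w) - p(t0) = w r(w) and let [a] be a common denominator for [r]: the difference is
    an integer multiple of [N] once the integer w is a multiple of N a. *)
Lemma congruent_values (p : {poly rat}) (t0 : rat) (N : nat) :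
  exists2 a : int, a != 0 & forall m : int, exists k : int,
    p.[t0 + (N%:Z * a * m)%:~R] - p.[t0] = (N%:Z * k)%:~R.
Proof.
pose g := p \Po ('X + t0%:P) - (p.[t0])%:P.
have /factor_theorem[r gr] : root g 0.
  by apply/rootP; rewrite hornerD hornerN hornerC horner_comp hornerD hornerX hornerC add0r subrr.
have [q [a a0 rE]] := rat_poly_scale r; exists a => // m.
exists (m * q.[N%:Z * a * m]); set w := N%:Z * a * m.
have -> : p.[t0 + w%:~R] - p.[t0] = r.[w%:~R] * w%:~R.
  transitivity g.[w%:~R]; last by rewrite gr hornerM hornerXsubC subr0.
  by rewrite hornerD hornerN hornerC horner_comp hornerD hornerX hornerC [w%:~R + _]addrC.
have a0' : a%:~R != 0 :> rat by rewrite intr_eq0.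
rewrite rE hornerZ (horner_map (intr : int -> rat)) /=.
rewrite {2}/w !intrM; by field.
Qed.

End RationalDescent.

Theorem mainTheorem17 (F : {poly {poly rat}}) :
  smooth_curve (toQbar F) ->
  ~ iso_A1 (toQbar F) ->
  ~ iso_Gm (toQbar F) ->
  (exists (G : {poly {poly algC}}) (S : seq algC),
     forall a : algC, (a = 0 \/ a \notin S) ->
       iso_A1 (G - a%:P%:P) /\
       (exists! p : algC * algC,
          ev2 (toQbar F) p.1 p.2 = 0 /\ ev2 G p.1 p.2 = a)) ->
  weak_approx (fun x y : rat => ev2 F x y < 0).
Proof.
move=> [nc irr _] nA1 nGm [G [S hS]] x0 y0 N N0.
have [Z Z0 hZ] := unique_curve_through_point (conj nc irr) nA1 nGm
  (fun a aS => hS a (or_intror aS)).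
(* The target point is moved within its class modulo [N] to avoid the zeros of [Z]. *)
have [i [j nz]] := nonzero_on_lattice x0 y0 N0 Z0.
set x := x0 + _ in nz; set y := y0 + _ in nz.
have [p1 [q1 [Fpq1 px1 qy1 uniq1]]] := hZ _ _ nz.
rewrite ev2_toQbar in px1 qy1 uniq1.
have [p [q [Fpq px qy]]] := unique_curve_rational Fpq1 px1 qy1 uniq1.
set t0 := ev2 F x y in px qy.
have [a a0 pa] := congruent_values p t0 N; have [b b0 qb] := congruent_values q t0 N.
pose M := Num.bound `|t0|.
(* [w] is a multiple of N a and of N b; the second factor a b makes it -N (ab)^2 M, at most -M for
   any signs of [a] and [b], so t0 + w < 0. *)
pose w : int := N%:Z * (a * b) * (- (a * b) * M%:Z).
have [k pk] := pa (b * (- (a * b) * M%:Z)); have [l ql] := qb (a * (- (a * b) * M%:Z)).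
have wp : N%:Z * a * (b * (- (a * b) * M%:Z)) = w by rewrite /w; ring.
have wq : N%:Z * b * (a * (- (a * b) * M%:Z)) = w by rewrite /w; ring.
rewrite wp px in pk; rewrite wq qy in ql.
exists p.[t0 + w%:~R], q.[t0 + w%:~R]; split; last split.
- have ab : 1 <= (a * b) ^+ 2.
    by rewrite -gtz0_ge1 exprn_even_gt0 //= mulf_neq0.
  have w_le : w <= - M%:Z.
    have -> : w = - (N%:Z * (a * b) ^+ 2 * M%:Z) by rewrite /w; ring.
    rewrite lerN2 ler_peMl // -[1]mulr1 ler_pM //.
  have Mt : t0 < M%:~R.
    by apply: le_lt_trans (ler_norm t0) _; apply: archi_boundP.
  rewrite Fpq; apply: le_lt_trans (_ : t0 - M%:~R < 0); last by rewrite subr_lt0.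
  by rewrite lerD2l -mulrNz ler_int.
- exists (k + i%:Z); rewrite mulrDr intrD -pk /x !intrM natrM; ring.
exists (l + j%:Z); rewrite mulrDr intrD -ql /y !intrM natrM; ring.
Qed.
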